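(* For every integer $n\ge0$ we have: (a) The map $\Theta_n\colon(F_n^-)^n\to\mathrm{Sch}$, $r\mapsto[G_r]=[F_n/N_r]$, is continuous. (b) The final topology (quotient topology from $(F_n^-)^n$ via $\Theta_n$) on its image $\mathrm{Sch}_{\le n}$ is the subspace topology induced from $\mathrm{Sch}$. (c) The subsets $\mathrm{Sch}_{\le n}$ and $\mathrm{Sch}_n$ are compact.
   Context: Fix a prime $p>2$ and a group $\{1,\sigma\}$ of order $2$. All homomorphisms of pro-$p$-groups are continuous, all subgroups are closed, and ''generated'' means topologically generated. A $\sigma$-pro-$p$-group is a pro-$p$-group $G$ with a continuous action of $\{1,\sigma\}$, written $a\mapsto{}^\sigma a$; $\sigma$-homomorphisms and $\sigma$-isomorphisms are the $\sigma$-equivariant ones. Put $G^-:=\{a\in G\mid {}^\sigma a=a^{-1}\}$, with the subspace topology. Let $d_G:=\dim_{\mathbb F_p}H^1(G,\mathbb F_p)$ be the minimal number of generators of $G$. Let $D_i(G)$ ($i\ge1$) be the Zassenhaus filtration (dimension subgroups mod $p$): $D_1(G)=G$, and $D_i(G)$ is generated by the $p$-th powers of elements of $D_{\lceil i/p\rceil}(G)$ and all $[D_j(G),D_k(G)]$ with $j+k=i$. $F_n$ is the free pro-$p$-group on $x_1,\dots,x_n$, made a $\sigma$-pro-$p$-group by ${}^\sigma x_i=x_i^{-1}$. For $r=(r_1,\dots,r_n)\in(F_n^-)^n$ let $N_r$ be the normal subgroup of $F_n$ generated by all conjugates of $r_1,\dots,r_n$, and $G_r:=F_n/N_r$. A weak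 Schur $\sigma$-group is a $\sigma$-pro-$p$-group $\sigma$-isomorphic to some $G_r$ with $n\ge0$, $r\in(F_n^-)^n$. $\mathrm{Sch}$ is the set of $\sigma$-isomorphism classes $[G]$ of weak Schur $\sigma$-groups, $\mathrm{Sch}_{\le n}:=\{[G]\in\mathrm{Sch}\mid d_G\le n\}$ and $\mathrm{Sch}_n:=\{[G]\in\mathrm{Sch}\mid d_G=n\}$. $\mathrm{Sch}$ carries the topology with basis the sets $U_{i,G}:=\{[H]\in\mathrm{Sch}\mid H/D_i(H)\cong G/D_i(G)\ \sigma\text{-isomorphic}\}$ for all $i\ge2$ and all weak Schur $\sigma$-groups $G$. The image of $\Theta_n$ is exactly $\mathrm{Sch}_{\le n}$. *)

(* Defs.v *)
From HB Require Import structures.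
From mathcomp Require Import all_boot all_order all_algebra.
From mathcomp Require Import all_classical.
From mathcomp Require Import topology.

Set Implicit Arguments.
Unset Strict Implicit.
Unset Printing Implicit Defensive.

Local Open Scope classical_set_scope.
Local Open Scope group_scope.
Local Open Scope quotient_scope.

HB.mixin Record isTopologicalGroup G of Group G & Topological G := {
  mulg_continuous : continuous (fun x : G * G => x.1 * x.2) ;
  invg_continuous : continuous (fun x : G => x^-1)
}.

#[short(type="topGroupType")]
HB.structure Definition TopologicalGroup :=
  {G of Group G & Topological G & isTopologicalGroup G}.

HB.mixin Record hasSigma G of TopologicalGroup G := {
  sigma : G -> G ;
  sigmaM : {morph sigma : x y / x * y} ;
  sigmaK : involutive sigma ;
  sigma_continuous : continuous sigma
}.

#[short(type="sigmaGroupType")]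
HB.structure Definition SigmaGroup := {G of TopologicalGroup G & hasSigma G}.

Section Subgroups.
Variable G : topGroupType.
Implicit Types (H N S A B : set G).

Definition is_subgroup H : Prop :=
  [/\ H 1, forall x y, H x -> H y -> H (x * y) & forall x, H x -> H x^-1].

Definition is_normal N : Prop :=
  is_subgroup N /\ forall x y, N x -> N (x ^ y).

Definition topgen S : set G :=
  smallest [set H | closed H /\ is_subgroup H] S.

Definition lcosets_of N : set (set G) :=
  range (fun x : G => [set x * y | y in N]).

Definition commutator A B : set G :=
  topgen [set z | exists x y, [/\ A x, B y & z = [~ x, y]]].

End Subgroups.

(* A profinite group, described as a compact Hausdorff group with a basis of
   neighbourhoods of 1 made of open normal subgroups, whose open normal
   subgroups all have index a power of p. *)
Definition pro_p (p : nat) (G : topGroupType) : Prop :=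
  [/\ compact [set: G], hausdorff_space G,
      forall U : set G, nbhs 1 U ->
        exists N, [/\ open N, is_normal N & N `<=` U]
    & forall N : set G, open N -> is_normal N ->
        exists k : nat, (lcosets_of N #= `I_(p ^ k))%card].


Section TopgenTheory.
Variable G : topGroupType.
Implicit Types S : set G.

Lemma topgen_closed_subgroup S : closed (topgen S) /\ is_subgroup (topgen S).
Proof.
split; first by apply: closed_bigI => A [[]].
split=> [A [[_ [A1 _ _]] _] //|x y Sx Sy A AS|x Sx A AS].
  by have [[_ [_ AM _]] _] := AS; apply: AM; [exact: Sx|exact: Sy].
by have [[_ [_ _ AV]] _] := AS; apply: AV; exact: Sx.
Qed.

Lemma sub_topgen S : S `<=` topgen S.
Proof. exact: sub_gen_smallest. Qed.

Lemma topgen_min S (A : set G) :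
  closed A -> is_subgroup A -> S `<=` A -> topgen S `<=` A.
Proof. by move=> cA sA SA; apply: smallest_sub. Qed.

End TopgenTheory.

Section SubgroupTheory.
Variables G H : topGroupType.
Implicit Types (S : set G) (x y : G).

Lemma morph1_of (f : G -> H) : {morph f : x y / x * y} -> f 1 = 1.
Proof. by move=> fM; apply: (@mulgI _ (f 1)); rewrite -fM !mulg1. Qed.

Lemma morphV_of (f : G -> H) :
  {morph f : x y / x * y} -> {morph f : x / x^-1}.
Proof.
move=> fM x; apply: (@mulgI _ (f x)).
by rewrite -fM !mulgV (morph1_of fM).
Qed.

Lemma subgroup_preimage (f : G -> H) (A : set H) :
  {morph f : x y / x * y} -> is_subgroup A -> is_subgroup (f @^-1` A).
Proof.
move=> fM [A1 AM AV]; split=> [|x y|x] /=.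
- by rewrite (morph1_of fM).
- by rewrite fM; apply: AM.
- by rewrite (morphV_of fM); apply: AV.
Qed.

Lemma topgen_morph (f : G -> H) S (T : set H) :
  {morph f : x y / x * y} -> continuous f ->
  (forall x, S x -> topgen T (f x)) -> forall x, topgen S x -> topgen T (f x).
Proof.
move=> fM fc ST; apply: topgen_min => //.
  apply: preimage_closed; first by move=> x _; apply: fc.
  by case: (topgen_closed_subgroup T).
by apply: subgroup_preimage => //; case: (topgen_closed_subgroup T).
Qed.

End SubgroupTheory.

Lemma mulgl_continuous (G : topGroupType) (x : G) : continuous (fun y => x * y).
Proof.
move=> y; apply: (@continuous_comp _ _ _ (fun y => (x, y)) (fun z : G * G => z.1 * z.2)).
  by apply: cvg_pair; [exact: cvg_cst|exact: cvg_id].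
exact: mulg_continuous.
Qed.

Lemma mulgr_continuous (G : topGroupType) (x : G) : continuous (fun y => y * x).
Proof.
move=> y; apply: (@continuous_comp _ _ _ (fun y => (y, x)) (fun z : G * G => z.1 * z.2)).
  by apply: cvg_pair; [exact: cvg_id|exact: cvg_cst].
exact: mulg_continuous.
Qed.

Lemma conjg_continuous (G : topGroupType) (x : G) : continuous (fun y => y ^ x).
Proof.
move=> y; apply: (@continuous_comp _ _ _ (fun y => y * x) (fun z => x^-1 * z)).
  exact: mulgr_continuous.
exact: mulgl_continuous.
Qed.

Record sigmaNormal (G : sigmaGroupType) := SigmaNormal {
  sn_set : set G ;
  sn_closed : closed sn_set ;
  sn_normal : is_normal sn_set ;
  sn_sigma : forall x, sn_set x -> sn_set (sigma x)
}.

Section Quotient.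
Variables (G : sigmaGroupType) (N0 : sigmaNormal G).
Local Notation N := (sn_set N0).
Implicit Types x y : G.

Let N1 : N 1. Proof. by have [[]] := sn_normal N0. Qed.
Let NM x y : N x -> N y -> N (x * y).
Proof. by have [[_ + _] _] := sn_normal N0; apply. Qed.
Let NV x : N x -> N x^-1.
Proof. by have [[_ _ +] _] := sn_normal N0; apply. Qed.
Let NJ x y : N x -> N (x ^ y).
Proof. by have [_ +] := sn_normal N0; apply. Qed.

Definition quot_rel x y : bool := `[< N (x^-1 * y) >].

Fact quot_rel_refl : reflexive quot_rel.
Proof. by move=> x; apply/asboolP; rewrite mulVg. Qed.

Fact quot_rel_sym : symmetric quot_rel.
Proof.
by move=> x y; apply/asboolP/asboolP => /NV; rewrite invgM invgK.
Qed.

Fact quot_rel_trans : transitive quot_rel.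
Proof.
move=> y x z /asboolP Nxy /asboolP Nyz; apply/asboolP.
by have := NM Nxy Nyz; rewrite -mulgA mulVKg.
Qed.

Canonical quot_equiv := EquivRel quot_rel quot_rel_refl quot_rel_sym quot_rel_trans.

Definition sigma_quot : Type := quotient_topology {eq_quot quot_equiv}.

HB.instance Definition _ := Quotient.copy sigma_quot (quotient_topology {eq_quot quot_equiv}).
HB.instance Definition _ := Topological.copy sigma_quot (quotient_topology {eq_quot quot_equiv}).

Definition qproj : G -> sigma_quot := \pi_sigma_quot.

Lemma qprojP x y : qproj x = qproj y <-> N (x^-1 * y).
Proof.
split=> [/(@eqmodP _ quot_equiv) /asboolP //|h].
by apply/(@eqmodP _ quot_equiv)/asboolP.
Qed.

Lemma qproj_surj (q : sigma_quot) : exists x, q = qproj x.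
Proof. by exists (repr q); rewrite /qproj reprK. Qed.

Lemma qproj_repr (q : sigma_quot) : qproj (repr q) = q.
Proof. exact: reprK. Qed.

Lemma repr_qproj x : N (x^-1 * repr (qproj x)).
Proof. by apply/qprojP; rewrite qproj_repr. Qed.

Definition quot_mul (q r : sigma_quot) := qproj (repr q * repr r).
Definition quot_inv (q : sigma_quot) := qproj (repr q)^-1.
Definition quot_sigma (q : sigma_quot) := qproj (sigma (repr q)).

Fact quot_mulE x y : quot_mul (qproj x) (qproj y) = qproj (x * y).
Proof.
apply/esym/qprojP; set u := repr _; set v := repr _.
have Nu : N (x^-1 * u) := repr_qproj x.
have Nv : N (y^-1 * v) := repr_qproj y.
have -> : (x * y)^-1 * (u * v) = (x^-1 * u) ^ y * (y^-1 * v).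
  by rewrite /conjg invgM !mulgA mulgK.
by apply: NM => //; apply: NJ.
Qed.

Fact quot_invE x : quot_inv (qproj x) = qproj x^-1.
Proof.
apply/esym/qprojP; set u := repr _; have Nu : N (x^-1 * u) := repr_qproj x.
rewrite invgK; have := NJ (x^-1) (NV Nu).
by rewrite /conjg invgM invgK !mulgA mulgK.
Qed.

Fact quot_sigmaE x : quot_sigma (qproj x) = qproj (sigma x).
Proof.
apply/esym/qprojP; set u := repr _; have Nu : N (x^-1 * u) := repr_qproj x.
by rewrite -(morphV_of sigmaM) -sigmaM; apply: sn_sigma.
Qed.

Let qP (P : sigma_quot -> Prop) : (forall x, P (qproj x)) -> forall q, P q.
Proof. by move=> h q; have [x ->] := qproj_surj q. Qed.

Fact quot_mulA : associative quot_mul.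
Proof. by elim/qP=> x; elim/qP=> y; elim/qP=> z; rewrite !quot_mulE mulgA. Qed.
Fact quot_mul1 : left_id (qproj 1) quot_mul.
Proof. by elim/qP=> x; rewrite !quot_mulE mul1g. Qed.
Fact quot_1mul : right_id (qproj 1) quot_mul.
Proof. by elim/qP=> x; rewrite !quot_mulE mulg1. Qed.
Fact quot_mulV : left_inverse (qproj 1) quot_inv quot_mul.
Proof. by elim/qP=> x; rewrite quot_invE !quot_mulE mulVg. Qed.
Fact quot_Vmul : right_inverse (qproj 1) quot_inv quot_mul.
Proof. by elim/qP=> x; rewrite quot_invE !quot_mulE mulgV. Qed.

HB.instance Definition _ := isGroup.Build sigma_quot
  quot_mulA quot_mul1 quot_1mul quot_mulV quot_Vmul.

Lemma qprojM : {morph qproj : x y / x * y}.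
Proof. by move=> x y; rewrite -quot_mulE. Qed.

Lemma qprojV : {morph qproj : x / x^-1}.
Proof. by move=> x; rewrite -quot_invE. Qed.

Lemma qproj_continuous : continuous qproj.
Proof. exact: pi_continuous. Qed.

Lemma qproj_open (U : set G) : open U -> open (qproj @` U).
Proof.
move=> oU; rewrite /open /= /quotient_open.
have -> : \pi_(quotient_topology {eq_quot quot_equiv}) @^-1` (qproj @` U) =
  \bigcup_(n in N) ((fun x => x * n) @^-1` U).
  apply/seteqP; split=> [x [u Uu /esym/qprojP ux]|x [n Nn Ux]].
    by exists (x^-1 * u) => //=; rewrite mulVKg.
  by exists (x * n) => //; apply/esym/qprojP; rewrite mulKg.
apply: bigcup_open => n _; apply: open_comp => // x _.
exact: mulgr_continuous.
Qed.

Lemma qproj_nbhs x (U : set G) : nbhs x U -> nbhs (qproj x) (qproj @` U).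
Proof.
rewrite !nbhsE => -[V [oV Vx] VU]; exists (qproj @` V); last exact: image_subset.
by split; [exact: qproj_open|exists x].
Qed.

Fact quot_mul_continuous : continuous (fun z : sigma_quot * sigma_quot => z.1 * z.2).
Proof.
move=> [q r]; have [x ->] := qproj_surj q; have [y ->] := qproj_surj r.
move=> /= A; rewrite -qprojM => /qproj_continuous.
move=> /(@mulg_continuous G (x, y)) [[U V] /= [Ux Vy] UVA].
exists (qproj @` U, qproj @` V); first by split; apply: qproj_nbhs.
move=> [_ _] /= [[u Uu <-] [v Vv <-]]; rewrite -qprojM.
exact: (UVA (u, v)).
Qed.

Fact quot_inv_continuous : continuous (fun q : sigma_quot => q^-1).
Proof.
elim/qP=> x A; rewrite -qprojV => /qproj_continuous /(@invg_continuous G x) Ax.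
apply: filterS (qproj_nbhs Ax) => _ [y Ay <-] /=.
by rewrite -qprojV.
Qed.

HB.instance Definition _ := isTopologicalGroup.Build sigma_quot
  quot_mul_continuous quot_inv_continuous.

Fact quot_sigmaM : {morph quot_sigma : x y / x * y}.
Proof.
by elim/qP=> x; elim/qP=> y; rewrite -qprojM !quot_sigmaE sigmaM qprojM.
Qed.

Fact quot_sigmaK : involutive quot_sigma.
Proof. by elim/qP=> x; rewrite !quot_sigmaE sigmaK. Qed.

Fact quot_sigma_continuous : continuous quot_sigma.
Proof.
elim/qP=> x A; rewrite quot_sigmaE => /qproj_continuous /(@sigma_continuous G x) Ax.
apply: filterS (qproj_nbhs Ax) => _ [y Ay <-] /=.
by rewrite quot_sigmaE.
Qed.

HB.instance Definition _ := hasSigma.Build sigma_quot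
  quot_sigmaM quot_sigmaK quot_sigma_continuous.

Lemma qproj_sigma : {morph qproj : x / sigma x}.
Proof. by move=> x; rewrite -quot_sigmaE. Qed.

Lemma qproj_eq1 x : qproj x = 1 <-> N x.
Proof.
split=> [/esym/qprojP|Nx]; first by rewrite invg1 mul1g.
by apply/esym/qprojP; rewrite invg1 mul1g.
Qed.

Lemma qproj_preimage_normal (M : set sigma_quot) :
  is_normal M -> is_normal (qproj @^-1` M).
Proof.
move=> [sM MJ]; split; first exact: subgroup_preimage qprojM sM.
by move=> x y /=; rewrite /conjg !qprojM qprojV; apply: MJ.
Qed.

Lemma qproj_image_normal (M : set G) : is_normal M -> is_normal (qproj @` M).
Proof.
move=> [[M1 MM MV] MJ]; split; first split.
- by exists 1.
- by move=> _ _ [x Mx <-] [y My <-]; exists (x * y); [exact: MM|rewrite qprojM].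
- by move=> _ [x Mx <-]; exists x^-1; [exact: MV|rewrite qprojV].
- move=> _ q [x Mx <-]; have [y ->] := qproj_surj q; exists (x ^ y); first exact: MJ.
  by rewrite /conjg !qprojM qprojV.
Qed.

Lemma quot_hausdorff : hausdorff_space sigma_quot.
Proof.
move=> q r; have [x ->] := qproj_surj q; have [y ->] := qproj_surj r.
move=> clqr; apply/qprojP; apply: contrapT => Nxy.
have /= oNC : open (~` N) by apply: closed_openC; exact: sn_closed.
have cf : continuous (fun z : G * G => z.1^-1 * z.2).
  move=> z; apply: (@continuous_comp _ _ _ (fun z : G * G => (z.1^-1, z.2))
    (fun z : G * G => z.1 * z.2)); last exact: mulg_continuous.
  apply: cvg_pair => /=; last exact: cvg_snd.
  by apply: continuous_comp; [exact: cvg_fst|exact: invg_continuous].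
have : nbhs (x, y) ((fun z : G * G => z.1^-1 * z.2) @^-1` (~` N)).
  by apply: cf; apply: open_nbhs_nbhs.
move=> [[U V] /= [Ux Vy] UVN].
have [_ [[u Uu <-] [v Vv vu]]] := clqr _ _ (qproj_nbhs Ux) (qproj_nbhs Vy).
by apply: (UVN (u, v)) => //=; apply/qprojP.
Qed.

Lemma quot_pro_p p : pro_p p G -> pro_p p sigma_quot.
Proof.
move=> [cG _ bG iG]; split.
- have -> : [set: sigma_quot] = qproj @` [set: G].
    by apply/seteqP; split=> // q _; have [x ->] := qproj_surj q; exists x.
  apply: continuous_compact => //; apply: continuous_subspaceT.
  exact: qproj_continuous.
- exact: quot_hausdorff.
- move=> U U1; have /bG [M [oM nM MU]] : nbhs 1 (qproj @^-1` U).
    by apply: qproj_continuous; rewrite (morph1_of qprojM).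
  exists (qproj @` M); split; [exact: qproj_open|exact: qproj_image_normal|].
  by move=> _ [x Mx <-]; apply: MU.
- move=> M oM nM.
  have [|k Mk] := iG _ _ (qproj_preimage_normal nM).
    by apply: open_comp => // x _; apply: qproj_continuous.
  exists k; apply: card_eq_trans Mk.
  have -> : lcosets_of (qproj @^-1` M) = (fun A => qproj @^-1` A) @` lcosets_of M.
    have eqc x : [set x * y | y in qproj @^-1` M] =
        qproj @^-1` [set qproj x * y | y in M].
      apply/seteqP; split=> [_ [y My <-] /=|z [m Mm /= mz]].
        by exists (qproj y) => //; rewrite qprojM.
      exists (x^-1 * z); last by rewrite mulVKg.
      by rewrite /= qprojM qprojV -mz mulKg.
    apply/seteqP; split=> [_ [x _ <-]|_ [_ [q _ <-] <-]].
      by rewrite eqc; exists [set qproj x * y | y in M] => //; exists (qproj x).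
    by have [x ->] := qproj_surj q; rewrite -eqc; exists x.
  rewrite card_eq_sym; apply: inj_card_eq => A B _ _ AB.
  apply/seteqP; split=> q; have [x ->] := qproj_surj q => Ax.
    by have : (qproj @^-1` A) x by []; rewrite AB.
  by have : (qproj @^-1` B) x by []; rewrite -AB.
Qed.

End Quotient.

Section Zassenhaus.
Variable p : nat.

Definition ceil_div (i : nat) : nat := ((i + p.-1) %/ p)%N.

Definition zassenhaus_step (G : topGroupType) (D : nat -> set G) (i : nat) : set G :=
  topgen ([set x ^+ p | x in D (ceil_div i)] `|`
          [set z | exists j k, [/\ 0 < j, 0 < k, (j + k)%N = i
                                 & commutator (D j) (D k) z]]).

(* The recursion refers to indices smaller than i only, so that i is a
   sufficient amount of fuel; see zassenhausE. *)
Fixpoint zassenhaus_rec (G : topGroupType) (fuel i : nat) : set G :=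
  if fuel is fuel'.+1 then
    if i <= 1 then [set: G] else zassenhaus_step (@zassenhaus_rec G fuel') i
  else [set: G].
Arguments zassenhaus_rec : clear implicits.

Definition zassenhaus (G : topGroupType) (i : nat) : set G := zassenhaus_rec G i i.
Arguments zassenhaus : clear implicits.

Lemma zassenhaus1 (G : topGroupType) : zassenhaus G 1 = [set: G].
Proof. by []. Qed.

Lemma ceil_div_lt i : 1 < p -> 1 < i -> ceil_div i < i.
Proof.
move=> p1 i1; rewrite /ceil_div ltn_divLR; last exact: ltnW.
rewrite -(prednK (ltnW p1)) mulnS ltn_add2l /=.
by apply: leq_ltn_trans (ltn_Pmull i1 _); rewrite ?mul1n // -ltnS prednK // ltnW.
Qed.

Lemma ceil_div_gt0 i : 1 < p -> 0 < i -> 0 < ceil_div i.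
Proof.
move=> p1 i0; rewrite /ceil_div divn_gt0; last exact: ltnW.
by rewrite -{1}(prednK (ltnW p1)) -add1n leq_add2r.
Qed.

Lemma zassenhaus_step_eq (G : topGroupType) (D E : nat -> set G) i :
  1 < p -> 1 < i -> (forall j, 0 < j < i -> D j = E j) ->
  zassenhaus_step D i = zassenhaus_step E i.
Proof.
move=> p1 i1 DE; rewrite /zassenhaus_step DE; last first.
  by rewrite ceil_div_gt0 ?ceil_div_lt // ltnW.
suff sub (D' E' : nat -> set G) : (forall j, 0 < j < i -> D' j = E' j) ->
    [set z | exists j k, [/\ 0 < j, 0 < k, (j + k)%N = i & commutator (D' j) (D' k) z]] `<=`
    [set z | exists j k, [/\ 0 < j, 0 < k, (j + k)%N = i & commutator (E' j) (E' k) z]].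
  by apply: (congr1 (fun A => topgen (_ `|` A))); apply/seteqP; split;
    apply: sub => // j ji; rewrite DE.
move=> DE' z [j [k [j0 k0 jk zjk]]]; exists j, k; split=> //.
have ji : 0 < j < i by rewrite j0 -jk -{1}(addn0 j) ltn_add2l.
have ki : 0 < k < i by rewrite k0 -jk -{1}(add0n k) ltn_add2r.
by rewrite -(DE' _ ji) -(DE' _ ki).
Qed.

Lemma zassenhaus_recE (G : topGroupType) i k l : 1 < p -> i <= k -> i <= l ->
  zassenhaus_rec G k i = zassenhaus_rec G l i.
Proof.
move=> p1; have [n] := ubnP i; elim: n i k l => // n IH i [|k] [|l] //=.
- by rewrite leqn0 => _ /eqP ->.
- by rewrite leqn0 => _ _ /eqP ->.
move=> in1 ik il; case: leqP => // i1; apply: zassenhaus_step_eq => // j /andP[j0 ji].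
by apply: IH; rewrite -ltnS; apply: leq_trans ji _.
Qed.

Lemma zassenhausE (G : topGroupType) i : 1 < p -> 1 < i ->
  zassenhaus G i = zassenhaus_step (zassenhaus G) i.
Proof.
case: i => // i p1 i1; rewrite {1}/zassenhaus /= leqNgt i1 /=.
apply: zassenhaus_step_eq => // j /andP[_ ji].
exact: zassenhaus_recE.
Qed.

Lemma closed_subgroupT (G : topGroupType) : closed [set: G] /\ is_subgroup [set: G].
Proof. by split=> //; exact: closedT. Qed.

Lemma zassenhaus_closed_subgroup (G : topGroupType) i :
  closed (zassenhaus G i) /\ is_subgroup (zassenhaus G i).
Proof.
case: i => [|i]; first exact: closed_subgroupT.
rewrite /zassenhaus /=; case: ifP => _; first exact: closed_subgroupT.
exact: topgen_closed_subgroup.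
Qed.

Lemma morphX_of (G H : topGroupType) (f : G -> H) n :
  {morph f : x y / x * y} -> {morph f : x / x ^+ n}.
Proof.
by move=> fM x; elim: n => [|n IH]; rewrite ?expg0 ?(morph1_of fM) // !expgS fM IH.
Qed.

Lemma morphR_of (G H : topGroupType) (f : G -> H) :
  {morph f : x y / x * y} -> {morph f : x y / [~ x, y]}.
Proof. by move=> fM x y; rewrite /commg /conjg !fM !(morphV_of fM). Qed.

Lemma zassenhaus_morph (G H : topGroupType) (f : G -> H) i :
  {morph f : x y / x * y} -> continuous f ->
  forall x, zassenhaus G i x -> zassenhaus H i (f x).
Proof.
move=> fM fc.
suff h k l x : zassenhaus_rec G k l x -> zassenhaus_rec H k l (f x) by move=> x; apply: h.
elim: k l x => // k IH l x /=; case: ifP => // _; move: x.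
apply: topgen_morph => // x [[y Dy <-]|[j [m [j0 m0 jm xjm]]]].
  by apply: sub_topgen; left; exists (f y); [exact: IH|rewrite (morphX_of _ fM)].
apply: sub_topgen; right; exists j, m; split=> //; move: x xjm.
apply: topgen_morph => // _ [y [z [Dy Dz ->]]]; apply: sub_topgen.
by exists (f y), (f z); split; [exact: IH|exact: IH|exact: morphR_of].
Qed.

Lemma zassenhaus_le (G : topGroupType) i j : 1 < p -> 0 < i -> i <= j ->
  zassenhaus G j `<=` zassenhaus G i.
Proof.
move=> p1.
have step n : forall k, 0 < k < n -> zassenhaus G k.+1 `<=` zassenhaus G k.
  elim: n => [k /andP[_] //|n IH k /andP[k0 kn]].
  have [->|k1] : k = 1%N \/ 1 < k by case: k k0 {kn} => [|[|]]; auto.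
    by rewrite zassenhaus1.
  have [clk sgk] := zassenhaus_closed_subgroup G k.
  rewrite [X in X `<=` _]zassenhausE //.
  apply: topgen_min => // z [[x Dx <-]|[a [b [a0 b0 ab zab]]]].
    rewrite zassenhausE //; apply: sub_topgen; left; exists x => //.
    have : ceil_div k.+1 = ceil_div k \/ ceil_div k.+1 = (ceil_div k).+1.
      rewrite /ceil_div addSn divnS; last exact: ltnW.
      by case: (_ %| _); [right|left]; rewrite ?add1n ?add0n.
    case=> ceq; rewrite ceq in Dx => //.
    apply: IH Dx; rewrite ceil_div_gt0 //=.
    by apply: leq_trans (ceil_div_lt p1 k1) _; rewrite -ltnS.
  move: z zab; apply: topgen_min => // _ [x [y [Dx Dy ->]]].
  rewrite zassenhausE //; apply: sub_topgen; right.
  case: a a0 ab Dx => // -[|a] _.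
    rewrite add1n => -[bk]; rewrite bk in Dy * => Dx.
    case: k k0 kn k1 bk Dy clk sgk => // k _ kn k1 bk Dy _ _.
    exists 1%N, k; split=> //; apply: sub_topgen; exists x, y; split=> //.
    by apply: IH Dy; apply/andP.
  rewrite addSn => -[abk] Dx.
  exists a.+1, b; split=> //; apply: sub_topgen; exists x, y; split=> //.
  apply: IH Dx => /=; rewrite -ltnS; apply: leq_trans kn.
  by rewrite ltnS -abk addSn ltnS -{1}(addn0 a) ltn_add2l.
move=> i0; elim: j => [|j IH]; first by rewrite leqn0 => /eqP i0'; rewrite i0' in i0.
rewrite leq_eqVlt => /orP[/eqP -> //|]; rewrite ltnS => ij.
apply: subset_trans (IH ij); apply: (step j.+1).
by rewrite ltnSn andbT; apply: leq_trans ij.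
Qed.

End Zassenhaus.

Arguments zassenhaus : clear implicits.

Section ZassenhausQuotient.
Variables (p : nat) (G : sigmaGroupType).

Fact zassenhaus_normal i : is_normal (zassenhaus p G i).
Proof.
split=> [|x y]; first by case: (zassenhaus_closed_subgroup p G i).
apply: (@zassenhaus_morph p G G (fun x => x ^ y)); last exact: conjg_continuous.
by move=> a b; rewrite conjMg.
Qed.

Fact zassenhaus_sigma i x : zassenhaus p G i x -> zassenhaus p G i (sigma x).
Proof. by apply: zassenhaus_morph; [exact: sigmaM|exact: sigma_continuous]. Qed.

Definition zassenhaus_sub i : sigmaNormal G :=
  SigmaNormal (zassenhaus_closed_subgroup p G i).1 (zassenhaus_normal i)
    (@zassenhaus_sigma i).

Definition zassenhaus_quot i : sigmaGroupType := sigma_quot (zassenhaus_sub i).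

End ZassenhausQuotient.

Definition sigma_iso (G H : sigmaGroupType) : Prop :=
  exists (f : G -> H) (g : H -> G),
    [/\ cancel f g, cancel g f, continuous f & continuous g] /\
    {morph f : x y / x * y} /\ {morph f : x / sigma x}.

Lemma sigma_iso_refl G : sigma_iso G G.
Proof. by exists id, id; split; split=> // x; apply: cvg_id. Qed.

Lemma sigma_iso_sym G H : sigma_iso G H -> sigma_iso H G.
Proof.
move=> [f [g [[fK gK fc gc] [fM fs]]]]; exists g, f; split=> //.
split=> [x y|x]; apply: (can_inj fK); first by rewrite fM !gK.
by rewrite fs !gK.
Qed.

Lemma sigma_iso_trans G H K : sigma_iso G H -> sigma_iso H K -> sigma_iso G K.
Proof.
move=> [f [g [[fK gK fc gc] [fM fs]]]] [f' [g' [[fK' gK' fc' gc'] [fM' fs']]]].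
exists (f' \o f), (g \o g'); split; split.
- exact: can_comp.
- exact: can_comp.
- by move=> x; apply: continuous_comp; [exact: fc|exact: fc'].
- by move=> x; apply: continuous_comp; [exact: gc'|exact: gc].
- by move=> x y /=; rewrite fM fM'.
- by move=> x /=; rewrite fs fs'.
Qed.

Lemma quot_factor (G Q : sigmaGroupType) (N : sigmaNormal G) (u : G -> Q) :
  continuous u -> {morph u : x y / x * y} -> {morph u : x / sigma x} ->
  (forall x, sn_set N x -> u x = 1) ->
  exists v : sigma_quot N -> Q,
    [/\ forall x, v (qproj N x) = u x, continuous v,
        {morph v : x y / x * y} & {morph v : x / sigma x}].
Proof.
move=> uc uM us uN; pose v (q : sigma_quot N) := u (repr q).
have vE x : v (qproj N x) = u x.
  rewrite /v; apply: (@mulgI _ (u x)^-1); rewrite mulVg -(morphV_of uM) -uM.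
  by apply: uN; exact: repr_qproj.
exists v; split=> //.
- apply/quotient_continuous; rewrite (_ : v \o _ = u) //.
  by apply/funext => y; exact: vE.
- move=> q r; have [x ->] := qproj_surj q; have [y ->] := qproj_surj r.
  by rewrite -qprojM !vE uM.
- by move=> q; have [x ->] := qproj_surj q; rewrite -qproj_sigma !vE us.
Qed.

Lemma zassenhaus_quot_image p (G : sigmaGroupType) (N : sigmaNormal G) i :
  1 < p -> sn_set N `<=` zassenhaus p G i ->
  forall k, 0 < k <= i ->
  zassenhaus p (sigma_quot N) k `<=` qproj N @` zassenhaus p G k.
Proof.
move=> p1 Ni k; have [n] := ubnP k; elim: n k => // n IH k kn /andP[k0 ki].
have [->|k1] : k = 1%N \/ 1 < k by case: k k0 {kn ki} => [|[|]]; auto.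
  by move=> q _; have [x ->] := qproj_surj q; exists x.
have [clk [D1 DM DV]] := zassenhaus_closed_subgroup p G k.
have Nk : sn_set N `<=` zassenhaus p G k.
  by apply: subset_trans Ni _; exact: zassenhaus_le.
have cli : closed (qproj N @` zassenhaus p G k).
  rewrite -openC.
  have -> : ~` (qproj N @` zassenhaus p G k) = qproj N @` (~` zassenhaus p G k).
    apply/seteqP; split=> [q qN|_ [x Dx <-] [y Dy /qprojP yx]].
      have [x qx] := qproj_surj q; exists x => // Dx; apply: qN.
      by exists x.
    by apply: Dx; rewrite -(mulVKg y x); apply: DM => //; apply: Nk.
  by apply: qproj_open; rewrite openC.
have kn' : k <= n by rewrite -ltnS.
have [sgi _] := qproj_image_normal N (zassenhaus_normal p G k).
rewrite zassenhausE //; apply: topgen_min.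
- exact: cli.
- by case: (qproj_image_normal N (zassenhaus_normal p G k)).
- move=> z [[q Dq <-]|[a [b [a0 b0 ab zab]]]].
    have [||x Dx <-] := IH _ _ _ _ Dq.
    + by apply: leq_trans (ceil_div_lt p1 k1) _; rewrite -ltnS.
    + rewrite ceil_div_gt0 //=; apply: leq_trans ki.
      by apply: ltnW; exact: ceil_div_lt.
    exists (x ^+ p); last by rewrite (morphX_of _ (@qprojM _ N)).
    by rewrite zassenhausE //; apply: sub_topgen; left; exists x.
  have ak : a < k by rewrite -ab -{1}(addn0 a) ltn_add2l.
  have bk : b < k by rewrite -ab -{1}(add0n b) ltn_add2r.
  have [y Dy <-] : (qproj N @` zassenhaus p G k) z.
    move: z zab; apply: topgen_min => // _ [q [r [Dq Dr ->]]].
    have [|x Dx <-] := IH _ (leq_trans ak kn') _ _ Dq.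
      by rewrite a0 /= (leq_trans (ltnW ak)).
    have [|y Dy <-] := IH _ (leq_trans bk kn') _ _ Dr.
      by rewrite b0 /= (leq_trans (ltnW bk)).
    exists [~ x, y]; last by rewrite (morphR_of (@qprojM _ N)).
    rewrite zassenhausE //; apply: sub_topgen; right; exists a, b; split=> //.
    by apply: sub_topgen; exists x, y.
  by exists y.
Qed.

Lemma zassenhaus_quot_le p (G H : sigmaGroupType) i j : 1 < p -> 0 < i -> i <= j ->
  sigma_iso (zassenhaus_quot p G j) (zassenhaus_quot p H j) ->
  sigma_iso (zassenhaus_quot p G i) (zassenhaus_quot p H i).
Proof.
move=> p1 i0 ij.
suff wlog_map (K L : sigmaGroupType) (f : zassenhaus_quot p K j -> zassenhaus_quot p L j) :
    continuous f -> {morph f : x y / x * y} -> {morph f : x / sigma x} ->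
    exists v : zassenhaus_quot p K i -> zassenhaus_quot p L i,
      [/\ forall x y, f (qproj _ x) = qproj _ y -> v (qproj _ x) = qproj _ y,
          continuous v, {morph v : x y / x * y} & {morph v : x / sigma x}].
  move=> [f [g [[fK gK fc gc] [fM fs]]]].
  have gM : {morph g : x y / x * y} by move=> x y; apply: (can_inj fK); rewrite fM !gK.
  have gs : {morph g : x / sigma x} by move=> x; apply: (can_inj fK); rewrite fs !gK.
  have [v [vE vc vM vs]] := wlog_map _ _ f fc fM fs.
  have [w [wE wc wM ws]] := wlog_map _ _ g gc gM gs.
  exists v, w; split; split=> //.
    move=> q; have [x ->] := qproj_surj q.
    have [y fxy] := qproj_surj (f (qproj _ x)).
    by rewrite (vE _ _ fxy); apply: wE; rewrite -fxy fK.
  move=> q; have [x ->] := qproj_surj q.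
  have [y fxy] := qproj_surj (g (qproj _ x)).
  by rewrite (wE _ _ fxy); apply: vE; rewrite -fxy gK.
move=> fc fM fs.
have [t [tE tc tM ts]] : exists t : zassenhaus_quot p L j -> zassenhaus_quot p L i,
    [/\ forall x, t (qproj _ x) = qproj _ x, continuous t,
        {morph t : x y / x * y} & {morph t : x / sigma x}].
  apply: quot_factor; [exact: qproj_continuous|exact: qprojM|exact: qproj_sigma|].
  by move=> x Dx; apply/qproj_eq1; exact: (zassenhaus_le p1 i0 ij).
pose u x := t (f (qproj (zassenhaus_sub p K j) x)).
have uc : continuous u.
  move=> x; apply: (@continuous_comp _ _ _ (fun x => f (qproj _ x)) t); last exact: tc.
  by apply: continuous_comp; [exact: qproj_continuous|exact: fc].
have uM : {morph u : x y / x * y} by move=> x y; rewrite /u qprojM fM tM.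
have us : {morph u : x / sigma x} by move=> x; rewrite /u qproj_sigma fs ts.
have [x Dx|v [vE vc vM vs]] := quot_factor (N := zassenhaus_sub p K i) uc uM us.
  have Dux := zassenhaus_morph uM uc Dx.
  have ii : 0 < i <= i by rewrite i0 leqnn.
  have [y Dy <-] := @zassenhaus_quot_image p L (zassenhaus_sub p L i) i p1
    (fun _ h => h) i ii _ Dux.
  exact/qproj_eq1.
exists v; split=> // x y fxy; by rewrite vE /u fxy tE.
Qed.

Lemma zassenhaus_quot_iso p (G H : sigmaGroupType) i : sigma_iso G H ->
  sigma_iso (zassenhaus_quot p G i) (zassenhaus_quot p H i).
Proof.
suff wlog_map (K L : sigmaGroupType) (f : K -> L) :
    continuous f -> {morph f : x y / x * y} -> {morph f : x / sigma x} ->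
    exists v : zassenhaus_quot p K i -> zassenhaus_quot p L i,
      [/\ forall x, v (qproj _ x) = qproj _ (f x),
          continuous v, {morph v : x y / x * y} & {morph v : x / sigma x}].
  move=> [f [g [[fK gK fc gc] [fM fs]]]].
  have gM : {morph g : x y / x * y} by move=> x y; apply: (can_inj fK); rewrite fM !gK.
  have gs : {morph g : x / sigma x} by move=> x; apply: (can_inj fK); rewrite fs !gK.
  have [v [vE vc vM vs]] := wlog_map _ _ f fc fM fs.
  have [w [wE wc wM ws]] := wlog_map _ _ g gc gM gs.
  exists v, w; split; split=> //.
    by move=> q; have [x ->] := qproj_surj q; rewrite vE wE fK.
  by move=> q; have [x ->] := qproj_surj q; rewrite wE vE gK.
move=> fc fM fs.
apply: (@quot_factor _ _ _ (fun x => qproj (zassenhaus_sub p L i) (f x))).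
- by move=> x; apply: continuous_comp; [exact: fc|exact: qproj_continuous].
- by move=> x y; rewrite fM qprojM.
- by move=> x; rewrite fs qproj_sigma.
- by move=> x Dx; apply/qproj_eq1; exact: zassenhaus_morph Dx.
Qed.

Definition minus_part (G : sigmaGroupType) : set G := [set a | sigma a = a^-1].

Arguments minus_part : clear implicits.

Section Presented.
Variables (G : sigmaGroupType) (n : nat) (r : 'I_n -> minus_part G).

Definition relators_closure : set G :=
  topgen [set x | exists i y, x = set_val (r i) ^ y].

Fact relators_closure_normal : is_normal relators_closure.
Proof.
split=> [|x y]; first by case: (topgen_closed_subgroup [set x | exists i y, x = set_val (r i) ^ y]).
apply: (@topgen_morph _ _ (fun x => x ^ y)); last first.
- by move=> _ [i [z ->]]; apply: sub_topgen; exists i, (z * y); rewrite conjgM.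
- exact: conjg_continuous.
- by move=> a b; rewrite conjMg.
Qed.

Fact relators_closure_sigma x : relators_closure x -> relators_closure (sigma x).
Proof.
apply: topgen_morph; [exact: sigmaM|exact: sigma_continuous|].
move=> _ [i [y ->]].
have /= ri : sigma (set_val (r i)) = (set_val (r i))^-1.
  by have := set_valP (r i).
have [_ [_ _ inv]] := topgen_closed_subgroup [set x | exists i y, x = set_val (r i) ^ y].
rewrite /conjg !sigmaM (morphV_of sigmaM) ri.
have -> : (sigma y)^-1 * ((set_val (r i))^-1 * sigma y) = (set_val (r i) ^ sigma y)^-1.
  by rewrite /conjg !invgM invgK mulgA.
by apply: inv; apply: sub_topgen; exists i, (sigma y).
Qed.

Definition relators_sub : sigmaNormal G :=
  SigmaNormal (topgen_closed_subgroup _).1 relators_closure_normal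
    relators_closure_sigma.

Definition presented : sigmaGroupType := sigma_quot relators_sub.

End Presented.

(* F_n, determined up to unique isomorphism by the universal property. *)
Record freeSigmaProP (p n : nat) := FreeSigmaProP {
  free_group :> sigmaGroupType ;
  free_gen : 'I_n -> free_group ;
  free_pro_p : pro_p p free_group ;
  free_universal : forall (H : topGroupType) (h : 'I_n -> H), pro_p p H ->
    exists! f : free_group -> H,
      [/\ continuous f, {morph f : x y / x * y} & forall i, f (free_gen i) = h i] ;
  free_sigma : forall i, sigma (free_gen i) = (free_gen i)^-1
}.

(* For the trivial action on F_p, continuous 1-cocycles are continuous
   homomorphisms and 1-coboundaries vanish. *)
Definition H1 (p : nat) (G : topGroupType) : set (G -> 'F_p) :=
  [set f | {morph f : x y / x * y >-> (x + y)%R} /\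
           continuous (f : G -> discrete_topology 'F_p)].

(* d is the dimension of H^1(G, F_p), as witnessed by a basis b. *)
Definition has_gen_rank (p : nat) (G : topGroupType) (d : nat) : Prop :=
  exists b : 'I_d -> G -> 'F_p,
    (forall i, H1 (b i)) /\
    forall f, H1 f -> exists! c : {ffun 'I_d -> 'F_p},
      f = fun x => (\sum_(i < d) c i * b i x)%R.

Section Schur.
Variables (p : nat) (p_pr : prime p) (F : forall n, freeSigmaProP p n).

Definition relators (n : nat) : topologicalType := {ptws 'I_n -> minus_part (F n)}.

Lemma presented_pro_p n (r : relators n) : pro_p p (presented r).
Proof. by apply: quot_pro_p; exact: free_pro_p. Qed.

Definition is_weak_schur (G : sigmaGroupType) : Prop :=
  pro_p p G /\ exists (n : nat) (r : relators n), sigma_iso G (presented r).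

Record weakSchur := WeakSchur {
  ws_group :> sigmaGroupType ;
  ws_weak_schur : is_weak_schur ws_group
}.

Fact presented_weak_schur n (r : relators n) : is_weak_schur (presented r).
Proof.
by split; [exact: presented_pro_p|exists n, r; exact: sigma_iso_refl].
Qed.

Definition presented_ws n (r : relators n) : weakSchur :=
  WeakSchur (presented_weak_schur r).

Definition presentation : choiceType := {n : nat & relators n}.

Definition presentation_group (P : presentation) : weakSchur :=
  presented_ws (tagged P).

Definition iso_rel (P Q : presentation) : bool :=
  `[< sigma_iso (presentation_group P) (presentation_group Q) >].

Fact iso_rel_refl : reflexive iso_rel.
Proof. by move=> P; apply/asboolP; exact: sigma_iso_refl. Qed.

Fact iso_rel_sym : symmetric iso_rel.
Proof. by move=> P Q; apply/asboolP/asboolP; exact: sigma_iso_sym. Qed.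

Fact iso_rel_trans : transitive iso_rel.
Proof.
move=> Q P R /asboolP PQ /asboolP QR; apply/asboolP; exact: sigma_iso_trans PQ QR.
Qed.

Canonical iso_equiv := EquivRel iso_rel iso_rel_refl iso_rel_sym iso_rel_trans.

(* The isomorphism classes are represented by classes of presentations, because
   a type whose elements are sets of sigmaGroupTypes lives in too large a
   universe to be a topologicalType; iso_class below maps every weak Schur
   sigma-group to its class, and iso_classP and iso_class_surj show that Sch is
   the quotient by sigma_iso. The topology depends on p being prime. *)
Definition Sch : Type := let _ := p_pr in {eq_quot iso_equiv}.
HB.instance Definition _ := Choice.copy Sch {eq_quot iso_equiv}.

Fact ws_presentation (G : weakSchur) :
  {P : presentation | sigma_iso G (presentation_group P)}.
Proof.
apply: cid; have [_ [n [r Gr]]] := ws_weak_schur G.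
by exists (Tagged relators r).
Qed.

Definition iso_class (G : weakSchur) : Sch := \pi_({eq_quot iso_equiv}) (sval (ws_presentation G)).

Lemma iso_classP (G H : weakSchur) : iso_class G = iso_class H <-> sigma_iso G H.
Proof.
rewrite /iso_class; case: (ws_presentation G) => P GP; case: (ws_presentation H) => Q HQ /=.
split=> [/(@eqmodP _ iso_equiv) /asboolP PQ|GH].
  exact: sigma_iso_trans GP (sigma_iso_trans PQ (sigma_iso_sym HQ)).
apply/(@eqmodP _ iso_equiv)/asboolP.
exact: sigma_iso_trans (sigma_iso_sym GP) (sigma_iso_trans GH HQ).
Qed.

Lemma iso_class_surj (c : Sch) : exists G : weakSchur, c = iso_class G.
Proof.
exists (presentation_group (repr c)); rewrite -[LHS]reprK /iso_class.
by case: (ws_presentation _) => Q PQ /=; apply/(@eqmodP _ iso_equiv)/asboolP.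
Qed.

Definition sch_nbhs (i : nat) (G : weakSchur) : set Sch :=
  [set c | exists H : weakSchur, c = iso_class H /\
    sigma_iso (zassenhaus_quot p H i) (zassenhaus_quot p G i)].

Definition sch_basis : set (set Sch) :=
  [set U | exists (i : nat) (G : weakSchur), 2 <= i /\ U = sch_nbhs i G].

Lemma sch_nbhsP i (G H : weakSchur) :
  sch_nbhs i G (iso_class H) <->
  sigma_iso (zassenhaus_quot p H i) (zassenhaus_quot p G i).
Proof.
split=> [[K [/iso_classP HK]]|HG]; last by exists H.
by apply: sigma_iso_trans; exact: zassenhaus_quot_iso.
Qed.

Definition sch_open : set (set Sch) :=
  [set A | forall c, A c -> exists U, [/\ sch_basis U, U c & U `<=` A]].

Fact sch_openT : sch_open setT.
Proof.
move=> c _; have [G cG] := iso_class_surj c.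
exists (sch_nbhs 2 G); split=> //; first by exists 2%N, G.
by exists G; split=> //; exact: sigma_iso_refl.
Qed.

Fact sch_openI : setI_closed sch_open.
Proof.
move=> A B oA oB c [Ac Bc]; have [K cK] := iso_class_surj c; rewrite {}cK in Ac Bc *.
have [_ [[i [G [i2 ->]]] /sch_nbhsP KG UA]] := oA _ Ac.
have [_ [[j [H [j2 ->]]] /sch_nbhsP KH UB]] := oB _ Bc.
have p1 := prime_gt1 p_pr.
exists (sch_nbhs (maxn i j) K); split.
- by exists (maxn i j), K; split=> //; rewrite leq_max i2.
- by apply/sch_nbhsP; exact: sigma_iso_refl.
move=> _ [L [-> LK]]; split; [apply: UA|apply: UB]; apply/sch_nbhsP.
  apply: sigma_iso_trans KG.
  by apply: zassenhaus_quot_le p1 _ _ LK; [exact: ltnW|exact: leq_maxl].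
apply: sigma_iso_trans KH.
by apply: zassenhaus_quot_le p1 _ _ LK; [exact: ltnW|exact: leq_maxr].
Qed.

Fact sch_open_bigU (I : Type) (f : I -> set Sch) :
  (forall i, sch_open (f i)) -> sch_open (\bigcup_i f i).
Proof.
move=> fo c [i _ fic]; have [U [bU Uc Uf]] := fo i c fic.
by exists U; split=> // d /Uf; exists i.
Qed.

HB.instance Definition _ :=
  isOpenTopological.Build Sch sch_openT sch_openI sch_open_bigU.

Lemma sch_basisP : basis sch_basis.
Proof.
split=> [U bU|c A].
  have oU : sch_open U by move=> c Uc; exists U; split.
  exact: oU.
rewrite nbhsE => -[B [oB Bc] BA]; have [U [bU Uc UB]] := oB c Bc.
by exists U => //; exact: subset_trans BA.
Qed.

Definition Sch_le (n : nat) : set Sch :=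
  [set c | exists G : weakSchur, c = iso_class G /\
    exists2 d : nat, has_gen_rank p G d & d <= n].

Definition Sch_eq (n : nat) : set Sch :=
  [set c | exists G : weakSchur, c = iso_class G /\ has_gen_rank p G n].

Definition Theta (n : nat) (r : relators n) : Sch := iso_class (presented_ws r).

End Schur.

Arguments Sch {p} p_pr F.
Arguments Theta {p} p_pr F n r.
Arguments Sch_le {p} p_pr F n.
Arguments Sch_eq {p} p_pr F n.

(* Main.v *)
(* Theta_n is continuous because D_i(F_n) is open and G_r / D_i(G_r) depends on r modulo
   D_i(F_n) only. The source of Theta_n is compact and Sch is Hausdorff: if all quotients
   G / D_i(G) and H / D_i(H) are isomorphic, then a cluster point of the tuples of
   generators of H chosen by these isomorphisms defines an isomorphism G -> H. Hence
   Theta_n is a closed map onto its image, which gives (b) and the compactness of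
   Sch_{<= n}. Sch_n is closed because d_G only depends on G / D_2(G).
   The image of Theta_n is Sch_{<= n}: adding a generator and killing it by a new relator
   raises n by one; if d_G < n, then some relator is nonzero in H_1(F_n, F_p), so it can
   replace one of the generators, and both can be eliminated. *)

Require Import Defs.
From HB Require Import structures.
From mathcomp Require Import all_boot all_order all_algebra.
From mathcomp Require Import all_fingroup all_solvable.
From mathcomp Require Import all_classical.
From mathcomp Require Import topology.

Set Implicit Arguments.
Unset Strict Implicit.
Unset Printing Implicit Defensive.

Local Open Scope classical_set_scope.
Local Open Scope group_scope.

(** * Finite quotients of pro-p groups *)

(** Two facts carry the topology: [D_i] is open in a finitely generated pro-p-group, and every
    neighbourhood of 1 in a pro-p-group contains some [D_i]. The obstacle to separating points of
    [Sch] is that the isomorphisms of [G / D_i(G)] with [H / D_i(H)] for different [i] need not be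
    compatible, so there is no inverse limit to take. Freeness lifts each of them to a homomorphism
    from [F_n] to [H], that is, to a point of the compact space [H^n]. Such a lift commutes with
    [sigma] only modulo [D_i(H)]; exact equivariance appears in the limit. As [F_n] is known only
    through its universal property, nothing is computed with words: generation and changes of basis
    are read off from homomorphisms to [F_p]. Eliminating a relator together with a generator
    respects [sigma] because [sigma] inverts relators just as it inverts generators. *)

Lemma pro_p_finite_quotient (p : nat) (G : topGroupType) (N : set G) :
  prime p -> pro_p p G -> open N -> is_normal N ->
  exists (gT : finGroupType) (f : G -> gT),
    [/\ {morph f : x y / x * y}, forall q, exists x, f x = q,
        p.-group [set: gT]%SET & forall x, f x = 1 <-> N x].
Proof.
move=> p_pr [_ _ _ iG] oN nN.
have [[N1 NM NV] NJ] := nN.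
have [k /card_set_bijP[b [bI binj bsurj]]] := iG N oN nN.
pose C x := [set x * y | y in N].
have CP x y : C x = C y <-> N (x^-1 * y).
  split=> [xy|Nxy].
    have : C y y by exists 1; rewrite ?mulg1.
    by rewrite -xy => -[z Nz <-]; rewrite mulKg.
  apply/seteqP; split=> _ [z Nz <-].
    exists ((x^-1 * y)^-1 * z); first by apply: NM => //; exact: NV.
    by rewrite invgM invgK !mulgA mulgV mul1g.
  by exists (x^-1 * y * z); [exact: NM|rewrite !mulgA mulgV mul1g].
have bC x : (b (C x) < p ^ k)%N by apply: bI; exists x.
(* The coset of [x] is replaced by its number below [p ^ k], and the group law of [G / N] is
   transported to these numbers; [s] picks a representative of each coset. *)
pose c x : 'I_(p ^ k) := Ordinal (bC x).
have cP x y : c x = c y <-> N (x^-1 * y).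
  split=> [[bxy]|Nxy]; last by apply: val_inj; rewrite /= (CP x y).2.
  by apply/CP; apply: binj => //; rewrite inE; [exists x|exists y].
have csurj i : exists x, c x = i.
  have [_ [x _ <-] bi] := bsurj i (ltn_ord i); exists x; exact: val_inj.
pose s i := sval (cid (csurj i)).
have sK i : c (s i) = i by rewrite /s; case: cid.
have cM x y x' y' : c x = c x' -> c y = c y' -> c (x * y) = c (x' * y').
  move=> /cP Nx /cP Ny; apply/cP.
  have -> : (x * y)^-1 * (x' * y') = (x^-1 * x') ^ y * (y^-1 * y').
    by rewrite /conjg invgM !mulgA mulgK.
  by apply: NM => //; apply: NJ.
have cV x x' : c x = c x' -> c x^-1 = c x'^-1.
  move=> /cP Nx; apply/cP; rewrite invgK.
  have := NJ _ x^-1 (NV _ Nx).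
  by rewrite /conjg invgM invgK !mulgA mulgK.
pose mul i j := c (s i * s j).
pose inv i := c (s i)^-1.
have mulE x y : mul (c x) (c y) = c (x * y) by apply: cM; rewrite sK.
have invE x : inv (c x) = c x^-1 by apply: cV; rewrite sK.
have mA : associative mul.
  by move=> i j l; rewrite -[i]sK -[j]sK -[l]sK !mulE mulgA.
have m1 : left_id (c 1) mul by move=> i; rewrite -[i]sK mulE mul1g.
have m1r : right_id (c 1) mul by move=> i; rewrite -[i]sK mulE mulg1.
have mV : left_inverse (c 1) inv mul by move=> i; rewrite -[i]sK invE mulE mulVg.
have mVr : right_inverse (c 1) inv mul by move=> i; rewrite -[i]sK invE mulE mulgV.
pose gG := isGroup.Build 'I_(p ^ k) mA m1 m1r mV mVr.
pose gT : finGroupType := HB.pack 'I_(p ^ k) gG.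
exists gT, c; split.
- by move=> x y; rewrite -mulE.
- exact: csurj.
- rewrite /pgroup; have -> : #|[set: gT]%SET| = (p ^ k)%N by rewrite cardsT card_ord.
  by rewrite pnatX pnat_id.
- move=> x; change (c x = c 1 <-> N x); split=> [/esym/cP|Nx].
    by rewrite invg1 mul1g.
  by apply/esym/cP; rewrite invg1 mul1g.
Qed.

Lemma group_morph1 (G H : groupType) (f : G -> H) :
  {morph f : x y / x * y} -> f 1 = 1.
Proof. by move=> fM; apply: (@mulgI _ (f 1)); rewrite -fM !mulg1. Qed.

Lemma group_morphV (G H : groupType) (f : G -> H) :
  {morph f : x y / x * y} -> {morph f : x / x^-1}.
Proof.
by move=> fM x; apply: (@mulgI _ (f x)); rewrite -fM !mulgV (group_morph1 fM).
Qed.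

Lemma group_morphX (G H : groupType) (f : G -> H) n :
  {morph f : x y / x * y} -> {morph f : x / x ^+ n}.
Proof.
by move=> fM x; elim: n => [|n IH]; rewrite ?expg0 ?(group_morph1 fM) // !expgS fM IH.
Qed.

Lemma group_morphR (G H : groupType) (f : G -> H) :
  {morph f : x y / x * y} -> {morph f : x y / [~ x, y]}.
Proof. by move=> fM x y; rewrite /commg /conjg !fM !(group_morphV fM). Qed.

(** [H] carries no topology here: [f] is locally constant, since translating a neighbourhood of 1
    inside the kernel by [x] gives a neighbourhood of [x] on which [f] is constant. *)
Lemma open_kernel_preimage (G : topGroupType) (H : groupType) (f : G -> H)
    (A : set H) :
  {morph f : x y / x * y} -> nbhs 1 (f @^-1` [set 1]) -> open (f @^-1` A).
Proof.
move=> fM f1; rewrite openE => x /= Afx; rewrite /interior.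
have : nbhs x ((fun y => x^-1 * y) @^-1` (f @^-1` [set 1])).
  by apply: mulgl_continuous; rewrite mulVg.
apply: filterS => y /= fxy; suff -> : f y = f x by [].
by rewrite -[y](mulKVg x) fM fxy mulg1.
Qed.

Lemma open_kernel_preimage_closed (G : topGroupType) (H : groupType) (f : G -> H)
    (A : set H) :
  {morph f : x y / x * y} -> nbhs 1 (f @^-1` [set 1]) -> closed (f @^-1` A).
Proof. by move=> fM f1; rewrite -openC preimage_setC; exact: open_kernel_preimage. Qed.

(** A discrete logarithm: the group is cyclic, and an exponent of the generator [c] is determined
    modulo the order [p] of [c]. *)
Lemma prime_group_log (p : nat) (gT : finGroupType) : prime p ->
  #|[set: gT]%SET| = p ->
  exists l : gT -> 'F_p, {morph l : x y / x * y >-> (x + y)%R} /\ injective l.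
Proof.
move=> p_pr cardT.
have /cyclicP[c defT] : cyclic [set: gT]%SET by apply: prime_cyclic; rewrite cardT.
have oc : #[c] = p by rewrite /order -defT.
have cP x : exists k, x = c ^+ k.
  by apply/cycleP; rewrite -defT inE.
pose l x : 'F_p := (sval (cid (cP x)))%:R%R.
have lE k : l (c ^+ k) = k%:R%R.
  rewrite /l; case: cid => m /= /eqP; rewrite eq_expg_mod_order oc => /eqP km.
  by apply: val_inj; rewrite /= !val_Fp_nat // km.
exists l; split=> [x y|x y].
  have [k ->] := cP x; have [m ->] := cP y.
  by rewrite -expgD !lE GRing.natrD.
have [k ->] := cP x; have [m ->] := cP y; rewrite !lE => /(congr1 val).
by rewrite /= !val_Fp_nat // => km; apply/eqP; rewrite eq_expg_mod_order oc km.
Qed.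

(* A proper closed subgroup lies in an open normal subgroup of index p, because
   a maximal subgroup of a finite p-group is normal of index p. *)
Lemma pro_p_frattini (p : nat) (G : topGroupType) (K : set G) :
  prime p -> pro_p p G -> closed K -> is_subgroup K -> K <> setT ->
  exists f : G -> 'F_p, [/\ H1 f, forall x, K x -> f x = 0%R & exists x, f x <> 0%R].
Proof.
move=> p_pr pG cK [K1 KM KV] KT.
have [x Kx] : exists x, ~ K x by apply/existsNP => KT'; apply: KT; apply/seteqP; split.
have [_ _ bG _] := pG.
(* As [K] is closed, some open normal [N] has [x N] disjoint from [K]; then [f x] lies outside the
   image [S] of [K], so [S] is a proper subgroup. *)
have : nbhs 1 ((fun y => x * y) @^-1` ~` K).
  by apply: mulgl_continuous; rewrite mulg1; apply: open_nbhs_nbhs; split=> //; rewrite openC.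
move=> /bG[N [oN nN NK]].
have [gT [f [fM fsurj pT fN]]] := pro_p_finite_quotient p_pr pG oN nN.
pose S : {set gT} := [set q | `[< exists2 y, K y & f y = q >]]%SET.
have SP q : reflect (exists2 y, K y & f y = q) (q \in S).
  by rewrite inE; apply: asboolP.
have gS : group_set S.
  apply/group_setP; split; first by apply/SP; exists 1 => //; exact: group_morph1 fM.
  move=> _ _ /SP[y Ky <-] /SP[z Kz <-]; apply/SP; exists (y * z); first exact: KM.
  by rewrite fM.
have [|ST|[M maxM SM]] := @maximal_exists _ (Group gS) [set: gT]%G.
- exact: finset.subsetT.
- have /SP[y Ky fyx] : f x \in S.
    by change (f x \in gval (Group gS)); rewrite ST inE.
  case: Kx; have : N (x^-1 * y) by apply/fN; rewrite fM fyx -fM mulVg (group_morph1 fM).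
  by move=> /NK /=; rewrite mulKVg.
have /andP[_ nM] := p_maximal_normal pT maxM.
have cosetT : [set: coset_of M]%SET = ([set: gT]%G / M)%g.
  apply/setP => q; rewrite inE; have [z zN ->] := cosetP q.
  by rewrite mem_quotient ?inE.
have [|l [lM linj]] := @prime_group_log p (coset_of M) p_pr.
  by rewrite cosetT card_quotient // (p_maximal_index pT maxM).
have NM z : z \in 'N(M)%g by apply: (fintype.subsetP nM); rewrite inE.
have l1 : l 1 = 0%R by apply: (@GRing.addrI _ (l 1)); rewrite -lM mulg1 GRing.addr0.
pose g y := l (coset M (f y)).
have gM : {morph g : x y / x * y >-> (x + y)%R}.
  by move=> y z; rewrite /g fM morphM ?NM // lM.
have g0 y : f y \in M -> g y = 0%R by move=> My; rewrite /g coset_id.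
exists g; split.
- split=> //; apply/continuousP => A _.
  have -> : g @^-1` A = f @^-1` [set z | A (l (coset M z))] by [].
  apply: open_kernel_preimage => //.
  apply: open_nbhs_nbhs; split; last exact: group_morph1 fM.
  by have -> : f @^-1` [set 1] = N by apply/seteqP; split=> y; move/fN.
- by move=> y Ky; apply: g0; apply: (fintype.subsetP SM); apply/SP; exists y.
have /properP[_ [z _ Mz]] := maxgroupp maxM.
have [y fy] := fsurj z; exists y; rewrite /g fy -l1 => /linj /coset_idr.
by rewrite NM => /(_ isT) zM; rewrite zM in Mz.
Qed.

(* Induction on the order of the p-group: if D_i dies in the quotient by a central
   subgroup of order p, then D_(p * i) dies, since i <= ceil (p * i / p) and one of
   two positive indices with sum p * i is at least i. *)
Lemma zassenhaus_finite_pgroup (p : nat) (G : topGroupType) (gT : finGroupType)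
    (f : G -> gT) :
  prime p -> {morph f : x y / x * y} -> nbhs 1 (f @^-1` [set 1]) ->
  p.-group [set: gT]%SET ->
  exists2 i, 0 < i & forall x, zassenhaus p G i x -> f x = 1.
Proof.
move=> p_pr; have [n] := ubnP #|[set: gT]%SET|.
elim: n => // n IH in gT f * => gTn fM f1 pT.
have p1 := prime_gt1 p_pr.
have [T1|T1] := eqVneq [set: gT]%SET 1%G.
  by exists 1%N => // x _; apply/set1P; rewrite -T1 inE.
have Z1 : 'Z([set: gT]%G)%G != 1%G.
  by apply: contraNneq T1 => /(congr1 val) /= /(trivg_center_pgroup pT) ->.
have pZ : p %| #|'Z([set: gT]%G)%G|.
  have [] := pgroup_pdiv (pgroupS (center_sub _) pT) Z1.
  by [].
have [c cZ oc] := Cauchy p_pr pZ.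
have cC z : commute c z.
  by move: cZ => /centerP[_ /(_ z)]; apply; rewrite inE.
have nC : <[c]> <| [set: gT]%SET.
  by rewrite /normal finset.subsetT /=; apply: cents_norm; apply/centsP => z _ _ /cycleP[k ->];
    apply: commuteX; apply: commute_sym.
have /andP[_ nCT] := nC.
have NC z : z \in 'N(<[c]>)%g by apply: (fintype.subsetP nCT); rewrite inE.
pose f' x := coset <[c]> (f x).
have f'M : {morph f' : x y / x * y} by move=> x y; rewrite /f' fM morphM ?NC.
have cosetT : [set: coset_of <[c]> ]%SET = ([set: gT]%G / <[c]>)%g.
  apply/setP => q; rewrite inE; have [z zN ->] := cosetP q.
  by rewrite mem_quotient ?inE.
have [||||i i0 Di] := IH _ f'.
- rewrite ltnS in gTn; rewrite cosetT; apply: leq_trans gTn.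
  rewrite ltn_quotient ?finset.subsetT //.
  by rewrite -cardG_gt1 -/(order _) oc.
- exact: f'M.
- by apply: filterS f1 => x /= fx; rewrite /f' fx morph1.
- by rewrite cosetT; apply: quotient_pgroup.
have Dc j x : i <= j -> zassenhaus p G j x -> f x \in <[c]>.
  by move=> ij /(zassenhaus_le p1 i0 ij) /Di /coset_idr; apply.
have ker_closed : closed (f @^-1` [set 1]) by apply: open_kernel_preimage_closed.
have ker_sub : is_subgroup (f @^-1` [set 1]).
  split=> [|x y|x] /=; first exact: group_morph1 fM.
    by move=> fx fy; rewrite fM [f x]fx [f y]fy mulg1.
  by move=> fx; rewrite (group_morphV fM) [f x]fx invg1.
have pi1 : 1 < p * i by apply: leq_trans p1 _; rewrite leq_pmulr.
exists (p * i)%N; first exact: ltnW.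
rewrite zassenhausE //; apply: topgen_min => //.
move=> z [[x Dx <-]|[a [b [a0 b0 ab zab]]]].
  have /cycleP[k fx] : f x \in <[c]>.
    apply: Dc Dx; rewrite /ceil_div mulnC divnMDl ?prime_gt0 //.
    exact: leq_addr.
  by rewrite /= (group_morphX _ fM) fx -expgM mulnC expgM -oc expg_order expg1n.
move: z zab; apply: topgen_min => // _ [x [y [Dx Dy ->]]] /=.
rewrite (group_morphR fM); apply/eqP/commgP.
have [ia|ai] := leqP i a.
  have /cycleP[k ->] := Dc _ _ ia Dx.
  by apply: commute_sym; apply: commuteX; apply: commute_sym.
have ib : i <= b.
  rewrite -(leq_add2l a) ab; apply: leq_trans (leq_mul p1 (leqnn i)).
  by rewrite mul2n -addnn leq_add2r ltnW.
have /cycleP[k ->] := Dc _ _ ib Dy.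
by apply: commuteX; apply: commute_sym.
Qed.

(** Wherever the [D_i] are also open, this makes them a basis of neighbourhoods of 1. The proof
    passes to a finite p-group quotient, in which some [D_i] dies. *)
Lemma zassenhaus_nbhs (p : nat) (G : topGroupType) (U : set G) :
  prime p -> pro_p p G -> nbhs 1 U ->
  exists2 i, 0 < i & zassenhaus p G i `<=` U.
Proof.
move=> p_pr pG U1; have [_ _ bG _] := pG; have [N [oN nN NU]] := bG U U1.
have [gT [f [fM _ pT fN]]] := pro_p_finite_quotient p_pr pG oN nN.
have [|i i0 Di] := zassenhaus_finite_pgroup p_pr fM _ pT.
  apply: open_nbhs_nbhs; split; last exact: group_morph1 fM.
  by have -> : f @^-1` [set 1] = N by apply/seteqP; split=> y; move/fN.
by exists i => // x /Di /fN /NU.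
Qed.

Lemma zassenhaus_cap (p : nat) (G : topGroupType) (x : G) :
  prime p -> pro_p p G -> (forall i, 0 < i -> zassenhaus p G i x) -> x = 1.
Proof.
move=> p_pr pG Dx; have [_ hG _ _] := pG; apply: contrapT => x1.
have [|i i0] := @zassenhaus_nbhs p G (~` [set x]) p_pr pG.
  apply: open_nbhs_nbhs; split; last by move=> /esym.
  by rewrite openC; apply: accessible_closed_set1; exact: hausdorff_accessible.
by move=> /(_ x (Dx i i0)); apply.
Qed.

(** * Openness of the Zassenhaus filtration *)

Section FiniteIndex.
Variable G : topGroupType.
Implicit Types (H K : set G) (S T W : seq G).

Definition finite_index K := exists T, forall x, exists2 t, t \in T & K (t^-1 * x).

Lemma closed_finite_translates K (T : seq G) : closed K ->
  closed [set x | exists2 t, t \in T & K (t^-1 * x)].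
Proof.
move=> cK; rewrite (_ : [set x | _] = \bigcup_(t in [set` T]) ((fun x => t^-1 * x) @^-1` K)).
  apply: closed_bigcup => [|t _]; first exact: finite_seq.
  apply: preimage_closed => // x _.
  exact: mulgl_continuous.
by apply/seteqP; split=> x [t tT Kx]; exists t.
Qed.

(** The complement is the union of the finitely many closed translates of [K] by those members of
    [T] that lie outside [K]. *)
Lemma finite_index_open K : closed K -> is_subgroup K -> finite_index K -> open K.
Proof.
move=> cK [K1 KM KV] [T TK].
rewrite -closedC (_ : ~` K =
    [set x | exists2 t, t \in [seq t <- T | `[< ~ K t >]] & K (t^-1 * x)]).
  exact: closed_finite_translates.
apply/seteqP; split=> x.
  move=> Kx; have [t tT Ktx] := TK x; exists t => //.
  rewrite mem_filter tT andbT; apply/asboolP => Kt; apply: Kx.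
  by rewrite -(mulKVg t x); apply: KM.
move=> [t + Ktx] Kx; rewrite mem_filter => /andP[/asboolP Kt _]; apply: Kt.
by rewrite -(invgK t) -[t^-1](mulgK x); apply: (KV); exact: KM Ktx (KV _ Kx).
Qed.

Section Step.
Variables (p : nat) (H K : set G).
Hypotheses (p_gt0 : 0 < p) (sH : is_subgroup H) (nK : is_normal K).
Hypotheses (HR : forall x y, H x -> H y -> K [~ x, y]).
Hypothesis (HX : forall x, H x -> K (x ^+ p)).

(** Modulo [K] the elements of [H] commute and have trivial [p]-th powers. So the products of powers
    [h ^+ e] with [h] in [hs] and [e < p] form a finite set that is stable, modulo [K], under
    multiplication by [hs]. *)
Lemma finite_span_mod (hs : seq G) : (forall h, h \in hs -> H h) ->
  exists W, [/\ 1 \in W, forall w, w \in W -> H w &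
    forall h w, h \in hs -> w \in W -> exists2 w', w' \in W & K (w'^-1 * (h * w))].
Proof.
have [[K1 KM KV] KJ] := nK; have [H1 HM HV] := sH.
elim: hs => [|h hs IH] Hhs; first exists [:: 1].
  by split; rewrite ?mem_head // => w; rewrite inE => /eqP ->.
have [|W [W1 WH Whs]] := IH; first by move=> g ghs; apply: Hhs; rewrite inE ghs orbT.
have Hh : H h by apply: Hhs; rewrite mem_head.
have Hhe e : H (h ^+ e) by elim: e => [|e IHe]; rewrite ?expg0 // expgS; apply: HM.
exists [seq h ^+ e * w | e <- iota 0 p, w <- W]; split.
- by apply/allpairsP; exists (0, 1); rewrite expg0 mulg1 mem_iota.
- by move=> _ /allpairsP[[e w] /= [_ Ww ->]]; apply: HM => //; exact: WH.
move=> g _ /[swap] /allpairsP[[e w] /= [+ Ww ->]].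
rewrite mem_iota add0n /= => ep; rewrite inE => /predU1P[->{g}|ghs].
  have [ep'|] := ltnP e.+1 p.
    exists (h ^+ e.+1 * w); last by rewrite (mulgA h) -expgS mulVg.
    by apply/allpairsP; exists (e.+1, w); rewrite mem_iota.
  (* At [e.+1 = p] the power of [h] falls into [K], and the exponent restarts at 0. *)
  move=> pe; have ep1 : e.+1 = p by apply/eqP; rewrite eqn_leq ep.
  exists w; first by apply/allpairsP; exists (0, w); rewrite mem_iota expg0 mul1g.
  by rewrite (mulgA h) -expgS ep1; apply: KJ; exact: HX.
have [w' Ww' Kw'] := Whs g w ghs Ww.
exists (h ^+ e * w'); first by apply/allpairsP; exists (e, w'); rewrite mem_iota.
have Hg : H g by apply: Hhs; rewrite inE ghs orbT.
have -> : (h ^+ e * w')^-1 * (g * (h ^+ e * w)) =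
    w'^-1 * (g * w) * ([~ g, h ^+ e] ^ w).
  by rewrite /commg /conjg !invgM !mulgA mulgK mulgK.
by apply: KM => //; apply: KJ; apply: HR.
Qed.

(* As in Schreier's lemma, a finite union of cosets t w K, with t in a transversal of H
   and w in a finite set spanning modulo K, is stable under the generators of G. *)
Lemma finite_index_step (S : seq G) :
  closed K -> topgen [set` S] = setT -> finite_index H -> finite_index K.
Proof.
move=> cK genS [T TH]; have [[K1 KM KV] KJ] := nK.
pose S' := S ++ [seq s^-1 | s <- S].
have tr x : {t | t \in T & H (t^-1 * x)} by apply: cid2; exact: TH.
pose tau x := s2val (tr x).
have tauT x : tau x \in T := s2valP (tr x).
have tauH x : H ((tau x)^-1 * x) := s2valP' (tr x).
(* [(tau (s * t))^-1 * (s * t)] is the Schreier generator of [H] attached to [s] and [t]. *)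
have [|W [W1 WH WS]] :=
    @finite_span_mod [seq (tau (s * t))^-1 * (s * t) | s <- S', t <- T].
  by move=> _ /allpairsP[[s t] [_ _ ->]].
pose X := [set x | exists2 u, u \in [seq t * w | t <- T, w <- W] & K (u^-1 * x)].
have cX : closed X by exact: closed_finite_translates.
have SX s x : s \in S' -> X x -> X (s * x).
  move=> sS [_ /allpairsP[[t w] /= [tT wW ->]] Kx].
  have [|w' w'W Kw] := WS ((tau (s * t))^-1 * (s * t)) w _ wW.
    by apply/allpairsP; exists (s, t).
  exists (tau (s * t) * w').
    by apply/allpairsP; exists (tau (s * t), w'); split=> //; exact: tauT.
  have -> : (tau (s * t) * w')^-1 * (s * x) =
      w'^-1 * ((tau (s * t))^-1 * (s * t) * w) * ((t * w)^-1 * x).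
    by rewrite !invgM !mulgA mulgK mulgK.
  exact: KM.
(* The stabilizer of [X] under left multiplication is a closed subgroup containing [S], hence all of
   [G]; as [X] is nonempty, it is all of [G] too. *)
pose L := [set g | forall x, X x -> X (g * x) /\ X (g^-1 * x)].
have LT : L = setT.
  apply/seteqP; split=> // g _; have : topgen [set` S] g by rewrite genS.
  move: g; apply: topgen_min.
  - rewrite (_ : L = \bigcap_(x in X) ((fun g => g * x) @^-1` X `&`
        (fun g => g^-1 * x) @^-1` X)).
      apply: closed_bigI => x _; apply: closedI; apply: preimage_closed => // g _.
        exact: mulgr_continuous.
      apply: (@continuous_comp _ _ _ (fun g => g^-1) (fun g => g * x)).
        exact: invg_continuous.
      exact: mulgr_continuous.
    by apply/seteqP; split=> g Lg x Xx; have := Lg x Xx.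
  - split=> [x Xx|g h Lg Lh x Xx|g Lg x Xx]; first by rewrite invg1 mul1g.
      rewrite invgM -!mulgA; split; last exact: (Lh _ (Lg _ Xx).2).2.
      exact: (Lg _ (Lh _ Xx).1).1.
    by rewrite invgK; have [] := Lg x Xx.
  - move=> s sS x Xx; split; apply: SX => //; rewrite mem_cat ?[s \in S]sS //.
    by rewrite map_f ?orbT.
exists [seq t * w | t <- T, w <- W] => x.
have XT : X (tau 1 * 1).
  exists (tau 1 * 1); last by rewrite mulVg.
  by apply/allpairsP; exists (tau 1, 1); split=> //; exact: tauT.
have : L (x * (tau 1 * 1)^-1) by rewrite LT.
by move=> /(_ _ XT) [+ _]; rewrite mulgKV.
Qed.

End Step.

(** Each [D_i / D_(i+1)] is elementary abelian: commutators of [D_i] lie in [[D_i, D_1]], and [p]-th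
    powers of [D_i] lie in [D_(i+1)] because the ceiling of [(i+1) / p] is at most [i]. *)
Lemma zassenhaus_finite_index (p : nat) (S : seq G) i : 1 < p ->
  topgen [set` S] = setT -> 0 < i -> finite_index (zassenhaus p G i).
Proof.
move=> p1 genS; elim: i => // -[|i] IH _; first by exists [:: 1] => x; exists 1; rewrite ?mem_head.
have [cD sD] := zassenhaus_closed_subgroup p G i.+1.
have [cD' sD'] := zassenhaus_closed_subgroup p G i.+2.
apply: (@finite_index_step p (zassenhaus p G i.+1)) cD' genS (IH isT) => //.
- exact: ltnW.
- split=> // x y; apply: (@zassenhaus_morph p G G (fun x => x ^ y)).
    by move=> a b; rewrite conjMg.
  exact: conjg_continuous.
- move=> x y Dx Dy; rewrite zassenhausE //; apply: sub_topgen; right.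
  exists i.+1, 1%N; rewrite addn1; split=> //; apply: sub_topgen.
  by exists x, y; rewrite zassenhaus1.
- move=> x Dx; rewrite zassenhausE //; apply: sub_topgen; left; exists x => //.
  by apply: zassenhaus_le Dx => //; rewrite ?ceil_div_gt0 // -ltnS ceil_div_lt.
Qed.

Lemma zassenhaus_open (p : nat) (S : seq G) i : 1 < p ->
  topgen [set` S] = setT -> 0 < i -> open (zassenhaus p G i).
Proof.
move=> p1 genS i0; have [cD sD] := zassenhaus_closed_subgroup p G i.
exact: finite_index_open (zassenhaus_finite_index p1 genS i0).
Qed.

End FiniteIndex.

(** * Surjections from compact groups *)

Lemma compact_map_closed (T U : topologicalType) (f : T -> U) (A : set T) :
  continuous f -> compact [set: T] -> hausdorff_space U -> closed A -> closed (f @` A).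
Proof.
move=> fc cT hU cA; apply: compact_closed => //; apply: continuous_compact.
  exact: continuous_subspaceT.
exact: (subclosed_compact cA cT).
Qed.

(* By compactness, q maps the closed subgroup D_k(A) to a closed subgroup. *)
Lemma zassenhaus_surj_image (p : nat) (A B : topGroupType) (q : A -> B) k :
  1 < p -> compact [set: A] -> hausdorff_space B ->
  {morph q : x y / x * y} -> continuous q -> (forall y, exists x, q x = y) ->
  0 < k -> zassenhaus p B k `<=` q @` zassenhaus p A k.
Proof.
move=> p1 cA hB qM qc qs; have [n] := ubnP k; elim: n k => // n IH k; rewrite ltnS => kn k0.
have [->|k1] : k = 1%N \/ 1 < k by case: k k0 {kn} => [|[|]]; auto.
  by move=> y _; have [x <-] := qs y; exists x.
have [cD [D1 DM DV]] := zassenhaus_closed_subgroup p A k.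
rewrite [X in X `<=` _]zassenhausE //; apply: topgen_min.
- exact: compact_map_closed.
- split; first by exists 1 => //; exact: group_morph1.
    move=> _ _ [x Dx <-] [y Dy <-]; exists (x * y); last exact: qM.
    exact: DM.
  move=> _ [x Dx <-]; exists x^-1; last exact: group_morphV.
  exact: DV.
- move=> z [[y Dy <-]|[a [b [a0 b0 ab zab]]]].
    have [||x Dx <-] := IH _ _ _ _ Dy.
    + exact: leq_trans (ceil_div_lt p1 k1) kn.
    + exact: ceil_div_gt0.
    exists (x ^+ p); last exact: group_morphX.
    by rewrite zassenhausE //; apply: sub_topgen; left; exists x.
  have ak : a < k by rewrite -ab -{1}(addn0 a) ltn_add2l.
  have bk : b < k by rewrite -ab -{1}(add0n b) ltn_add2r.
  move: z zab; apply: topgen_min.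
  + exact: compact_map_closed.
  + split; first by exists 1 => //; exact: group_morph1.
      move=> _ _ [x Dx <-] [y Dy <-]; exists (x * y); last exact: qM.
      exact: DM.
    move=> _ [x Dx <-]; exists x^-1; last exact: group_morphV.
    exact: DV.
  move=> _ [y [z [Dy Dz ->]]].
  have [x Dx <-] := IH _ (leq_trans ak kn) a0 _ Dy.
  have [x' Dx' <-] := IH _ (leq_trans bk kn) b0 _ Dz.
  exists [~ x, x']; last exact: group_morphR.
  rewrite zassenhausE //; apply: sub_topgen; right; exists a, b; split=> //.
  by apply: sub_topgen; exists x, x'.
Qed.

(** Both targets are [A] modulo the common kernel. The induced map is continuous because, by
    compactness of [A], the maps [f] and [g] send closed sets to closed sets. *)
Lemma sigma_iso_of_ker (A B C : sigmaGroupType) (f : A -> B) (g : A -> C) :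
  compact [set: A] -> hausdorff_space B -> hausdorff_space C ->
  continuous f -> {morph f : x y / x * y} -> {morph f : x / sigma x} ->
  (forall y, exists x, f x = y) ->
  continuous g -> {morph g : x y / x * y} -> {morph g : x / sigma x} ->
  (forall y, exists x, g x = y) ->
  (forall x, f x = 1 <-> g x = 1) -> sigma_iso B C.
Proof.
move=> cA; suff wlog_map (K L : sigmaGroupType) (u : A -> K) (v : A -> L) :
    hausdorff_space K -> hausdorff_space L ->
    continuous u -> {morph u : x y / x * y} -> {morph u : x / sigma x} ->
    (forall y, exists x, u x = y) ->
    continuous v -> {morph v : x y / x * y} -> {morph v : x / sigma x} ->
    (forall x, u x = 1 -> v x = 1) ->
    exists w : K -> L, [/\ forall x, w (u x) = v x, continuous w,
      {morph w : x y / x * y} & {morph w : x / sigma x}].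
  move=> hB hC fc fM fs fsurj gc gM gs gsurj fg.
  have [|v [vE vc vM vs]] := wlog_map B C f g hB hC fc fM fs fsurj gc gM gs.
    by move=> x /fg.
  have [|w [wE wc wM ws]] := wlog_map C B g f hC hB gc gM gs gsurj fc fM fs.
    by move=> x /fg.
  exists v, w; split; split=> // y.
    by have [x <-] := fsurj y; rewrite vE wE.
  by have [x <-] := gsurj y; rewrite wE vE.
move=> hK hL uc uM us usurj vc vM vs uv.
pose w y := v (sval (cid (usurj y))).
have wE x : w (u x) = v x.
  rewrite /w; case: cid => z /= uz; apply: (@mulgI _ (v x)^-1).
  by rewrite mulVg -(group_morphV vM) -vM uv // uM (group_morphV uM) uz mulVg.
exists w; split=> //.
- apply/continuous_closedP => D cD.
  have -> : w @^-1` D = u @` (v @^-1` D).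
    apply/seteqP; split=> [y /= wD|_ [x /= vD <-]]; last by rewrite /= wE.
    by have [x xy] := usurj y; exists x => //=; rewrite -wE xy.
  apply: compact_map_closed => //; apply: preimage_closed => //.
- by move=> y z; have [x <-] := usurj y; have [x' <-] := usurj z; rewrite -uM !wE vM.
- by move=> y; have [x <-] := usurj y; rewrite -us !wE vs.
Qed.

(** * Homomorphisms to F_p *)

(* The additive group F_p as a discrete group in multiplicative notation: x * y is x + y. *)
Definition Fp_group (p : nat) : Type := discrete_topology 'F_p.

HB.instance Definition _ p := Topological.copy (Fp_group p) (discrete_topology 'F_p).
HB.instance Definition _ p := isGroup.Build (Fp_group p)
  (@GRing.addrA 'F_p) (@GRing.add0r 'F_p) (@GRing.addr0 'F_p)
  (@GRing.addNr 'F_p) (@GRing.addrN 'F_p).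

Fact Fp_nbhs1 p (x : Fp_group p) : nbhs x [set x].
Proof. exact: (@discrete_set1 (discrete_topology 'F_p)). Qed.

Fact Fp_mulg_continuous p : continuous (fun x : Fp_group p * Fp_group p => x.1 * x.2).
Proof.
move=> [x y] A Axy; exists ([set x], [set y]).
  by split; exact: Fp_nbhs1.
by move=> [_ _] [/= -> ->]; exact: (nbhs_singleton Axy).
Qed.

Fact Fp_invg_continuous p : continuous (fun x : Fp_group p => x^-1).
Proof.
move=> x A /nbhs_singleton Ax.
by have := @Fp_nbhs1 p x; apply: (@filterS _ (nbhs x)) => _ ->.
Qed.

HB.instance Definition _ p := isTopologicalGroup.Build (Fp_group p)
  (@Fp_mulg_continuous p) (@Fp_invg_continuous p).

(** This admits [F_p] as a target in the universal property of [F_n], so that a class in H^1 of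
    [F_n] can be prescribed freely on the generators. *)
Lemma Fp_pro_p p : prime p -> pro_p p (Fp_group p).
Proof.
move=> p_pr; split.
- have fT : finite_set [set: Fp_group p] := @finite_finset 'F_p setT.
  exact: (@finite_compact (Fp_group p)).
- by move=> x y /(_ _ _ (@Fp_nbhs1 p x) (@Fp_nbhs1 p y)) [z [-> ->]].
- move=> U /nbhs_singleton U1.
  have o1 : open [set (1 : Fp_group p)] := @discrete_open (discrete_topology 'F_p) _.
  exists [set 1]; split=> //; last by move=> _ ->.
  split; first split=> [|x y -> ->|x ->] //; rewrite ?mulg1 ?invg1 //.
  by move=> x y ->; rewrite /= conj1g.
- move=> N _ [[N1 NM NV] _].
  have [N1'|] := pselect (forall x, N x -> x = 1).
    have -> : N = [set 1] by apply/seteqP; split=> [x /N1' ->|x ->].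
    have cF : ([set: 'I_(Zp_trunc (pdiv p)).+2] #= `I_p)%card.
      have -> : `I_p = `I_(Zp_trunc (pdiv p)).+2 by rewrite Fp_cast.
      by rewrite card_eq_sym; exact: card_II.
    exists 1%N; rewrite expn1; apply: card_eq_trans cF.
    apply: (@inj_card_eq (Fp_group p) _ setT) => x y _ _ xy.
    have : [set x * z | z in [set 1]] x by exists 1; rewrite ?mulg1.
    by rewrite xy => -[_ -> <-]; rewrite mulg1.
  move=> /existsNP[x /not_implyP[Nx x1]].
  have NT : N = setT.
    apply/seteqP; split=> // y _.
    have xu : (x : 'F_p) \is a GRing.unit by rewrite GRing.unitfE; apply/eqP.
    have -> : y = ((x : 'F_p) *+ val ((y : 'F_p) / x))%R :> 'F_p.
      by rewrite -GRing.mulr_natr natr_Zp GRing.mulrC GRing.divrK.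
    elim: (val _) => [|k IH]; first by rewrite GRing.mulr0n.
    by rewrite GRing.mulrS; exact: (NM x).
  exists 0%N; rewrite NT expn0.
  rewrite (_ : lcosets_of _ = [set setT]); first exact: card_set1.
  apply/seteqP; split=> [_ [y _ <-]|_ ->].
    by apply/seteqP; split=> // z _; exists (y^-1 * z) => //; rewrite mulKVg.
  by exists 1 => //; apply/seteqP; split=> // z _; exists z; rewrite ?mul1g.
Qed.

Lemma continuous_mulg (T : topologicalType) (H : topGroupType) (f g : T -> H) :
  continuous f -> continuous g -> continuous (fun x => f x * g x).
Proof.
move=> fc gc x.
apply: (@continuous_comp _ _ _ (fun x => (f x, g x)) (fun z : H * H => z.1 * z.2)).
  by apply: cvg_pair; [exact: fc|exact: gc].
exact: mulg_continuous.
Qed.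

Lemma continuous_invg (T : topologicalType) (H : topGroupType) (f : T -> H) :
  continuous f -> continuous (fun x => (f x)^-1).
Proof.
move=> fc x; apply: (@continuous_comp _ _ _ f (fun y => y^-1)); first exact: fc.
exact: invg_continuous.
Qed.

Lemma closed_group_eq (G H : topGroupType) (f g : G -> H) :
  hausdorff_space H -> continuous f -> continuous g -> closed [set x | f x = g x].
Proof.
move=> hH fc gc; have c1 : closed [set (1 : H)].
  by apply: accessible_closed_set1; exact: hausdorff_accessible.
rewrite (_ : [set x | _] = (fun x => (f x)^-1 * g x) @^-1` [set 1]).
  apply: preimage_closed => // x _.
  by apply: continuous_mulg => //; exact: continuous_invg.
by apply/seteqP; split=> x /= => [->|/(canRL (mulKVg _))]; rewrite ?mulVg // mulg1.
Qed.

Lemma topgen_hom_eq (G H : topGroupType) (S : set G) (f g : G -> H) :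
  topgen S = setT -> hausdorff_space H ->
  continuous f -> {morph f : x y / x * y} -> continuous g -> {morph g : x y / x * y} ->
  (forall x, S x -> f x = g x) -> forall x, f x = g x.
Proof.
move=> genS hH fc fM gc gM fg x.
have : topgen S x by rewrite genS.
move: x; apply: topgen_min => //; first exact: closed_group_eq.
split=> [|x y|x] /=; first by rewrite !(group_morph1, fM, gM).
  by rewrite fM gM => -> ->.
by rewrite !group_morphV // => ->.
Qed.

Section CohomologyH1.
Variables (p : nat) (p_pr : prime p).
Implicit Types G Q : topGroupType.

Lemma H1_hom G (f : G -> 'F_p) : H1 f <->
  continuous (f : G -> Fp_group p) /\ {morph (f : G -> Fp_group p) : x y / x * y}.
Proof. by split=> -[]. Qed.

Lemma H1_comp G Q (u : G -> Q) (f : Q -> 'F_p) :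
  continuous u -> {morph u : x y / x * y} -> H1 f -> H1 (f \o u).
Proof.
move=> uc uM /H1_hom[fc fM]; apply/H1_hom; split=> [x|x y].
  by apply: continuous_comp; [exact: uc|exact: fc].
by rewrite /= uM; exact: fM.
Qed.

Lemma H1_eq G (S : set G) (f g : G -> 'F_p) : topgen S = setT ->
  H1 f -> H1 g -> (forall x, S x -> f x = g x) -> f = g.
Proof.
move=> genS /H1_hom[fc fM] /H1_hom[gc gM] fg; apply/funext.
have [_ hF _ _] := Fp_pro_p p_pr.
exact: (@topgen_hom_eq G (Fp_group p) S f g).
Qed.

Lemma H1_ker G (f : G -> 'F_p) : H1 f ->
  closed [set x | f x = 0%R] /\ is_subgroup [set x | f x = 0%R].
Proof.
move=> /H1_hom[fc fM]; have [_ hF _ _] := Fp_pro_p p_pr; split.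
  apply: (@closed_group_eq G (Fp_group p) f (fun=> 1)) => // x; exact: cvg_cst.
split=> [|x y /= fx fy|x /= fx]; first exact: (group_morph1 fM).
  by apply: (etrans (fM x y)); rewrite fx fy; exact: (mulg1 (1 : Fp_group p)).
by apply: (etrans (group_morphV fM x)); rewrite fx; exact: (invg1 (Fp_group p)).
Qed.

Lemma H1_mulV G (f : G -> 'F_p) x y : H1 f -> f (x^-1 * y) = 0%R <-> f x = f y.
Proof.
move=> /H1_hom[_ fM].
have -> : f (x^-1 * y) = ((f x : Fp_group p)^-1 * f y : Fp_group p).
  by rewrite -(group_morphV fM) -fM.
split=> [/(canRL (mulKVg _))|->]; last exact: (mulVg (f y : Fp_group p)).
by rewrite (mulg1 (f x : Fp_group p)) => ->.
Qed.

Lemma H1_lin G d (b : 'I_d -> G -> 'F_p) (c : 'I_d -> 'F_p) : (forall i, H1 (b i)) ->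
  H1 (fun x => \sum_(i < d) c i * b i x)%R.
Proof.
move=> bH; elim: (index_enum _) => [|i s IH].
  have -> : (fun x => \sum_(i <- [::]) c i * b i x)%R = (fun=> 0%R).
    by apply/funext => x; rewrite big_nil.
  apply/H1_hom; split=> [x|x y]; last exact: esym (mulg1 (1 : Fp_group p)).
  exact: (@cvg_cst (Fp_group p)).
move: IH; set g := (fun x => _) => /H1_hom[gc gM]; have /H1_hom[bc bM] := bH i.
have -> : (fun x => \sum_(j <- i :: s) c j * b j x)%R = (fun x => c i * b i x + g x)%R.
  by apply/funext => x; rewrite big_cons.
apply/H1_hom; split=> [|x y].
  apply: (@continuous_mulg G (Fp_group p)) gc => x.
  apply: (@continuous_comp G (Fp_group p) (Fp_group p) (b i) (fun y => c i * y)%R).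
    exact: bc.
  move=> A /nbhs_singleton Ay; have := @Fp_nbhs1 p (b i x).
  by apply: (@filterS _ (nbhs (b i x : Fp_group p))) => _ ->.
rewrite (gM x y : g _ = (g x + g y)%R) (bM x y : b i _ = (b i x + b i y)%R) GRing.mulrDr.
exact: GRing.addrACA.
Qed.

(** [p]-th powers die since [F_p] has characteristic [p], commutators since it is commutative. Hence
    [G] and [G / D_2(G)] have the same H^1, and so the same [d_G]. *)
Lemma H1_zassenhaus2 G (f : G -> 'F_p) : H1 f -> forall x, zassenhaus p G 2 x -> f x = 0%R.
Proof.
move=> fH; have [cK sK] := H1_ker fH; have [_ fM] := (H1_hom f).1 fH.
have p1 := prime_gt1 p_pr.
rewrite zassenhausE //; apply: topgen_min => // z [[x _ <-]|[a [b [_ _ _ zab]]]].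
  apply: (etrans (group_morphX p fM x)).
  have -> k : (f x : Fp_group p) ^+ k = (f x *+ k)%R.
    by elim: k => // k IH; rewrite expgS GRing.mulrS IH.
  by rewrite -GRing.mulr_natr (GRing.pcharf0 (pchar_Fp p_pr)) GRing.mulr0.
move: z zab; apply: topgen_min => // _ [x [y [_ _ ->]]].
apply: (etrans (group_morphR fM x y)).
apply: (@eqP (Fp_group p)); apply/commgP; exact: (GRing.addrC (f x)).
Qed.

End CohomologyH1.

(** * Free groups and presentations *)

Section FreeGroups.
Variables (p : nat) (p_pr : prime p).

(** If the generators lay in a proper closed subgroup, a nonzero homomorphism to [F_p] would vanish
    on them, against the uniqueness in the universal property. *)
Lemma free_gen_topgen n (F : freeSigmaProP p n) :
  topgen (range (@free_gen p n F)) = setT.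
Proof.
apply: contrapT => genT.
have [cK sK] := topgen_closed_subgroup (range (@free_gen p n F)).
have [f [fH fK [x fx]]] := pro_p_frattini p_pr (free_pro_p F) cK sK genT.
have [u [_ uU]] := free_universal F (fun _ => 1) (Fp_pro_p p_pr).
have /H1_hom[fc fM] := fH.
apply: fx; rewrite -[f]uU; last first.
  by split=> // i; apply: fK; apply: sub_topgen; exists i.
rewrite (uU (fun=> 1)) //; split=> //.
  by move=> y; exact: cvg_cst.
by move=> y z; rewrite mulg1.
Qed.

Lemma free_hom_ex n (F : freeSigmaProP p n) (H : topGroupType) (h : 'I_n -> H) :
  pro_p p H -> exists f : F -> H,
    [/\ continuous f, {morph f : x y / x * y} & forall i, f (free_gen F i) = h i].
Proof. by move=> /(free_universal F h)[f []]; exists f. Qed.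

Lemma free_hom_eq n (F : freeSigmaProP p n) (H : topGroupType) (f g : F -> H) :
  hausdorff_space H -> continuous f -> {morph f : x y / x * y} ->
  continuous g -> {morph g : x y / x * y} ->
  (forall i, f (free_gen F i) = g (free_gen F i)) -> forall x, f x = g x.
Proof.
move=> hH fc fM gc gM fg; apply: (topgen_hom_eq (free_gen_topgen F)) => //.
by move=> _ [i _ <-].
Qed.

Lemma free_hom_sigma n (F : freeSigmaProP p n) (H : sigmaGroupType) (f : F -> H) :
  hausdorff_space H -> continuous f -> {morph f : x y / x * y} ->
  (forall i, minus_part H (f (free_gen F i))) -> {morph f : x / sigma x}.
Proof.
move=> hH fc fM fs; apply: free_hom_eq => //.
- by move=> x; apply: continuous_comp; [exact: sigma_continuous|exact: fc].
- by move=> x y; rewrite sigmaM fM.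
- by move=> x; apply: continuous_comp; [exact: fc|exact: sigma_continuous].
- by move=> x y; rewrite fM sigmaM.
- by move=> i; rewrite free_sigma (group_morphV fM) fs.
Qed.

Lemma free_H1_ex n (F : freeSigmaProP p n) (c : 'I_n -> 'F_p) :
  exists2 f : F -> 'F_p, H1 f & forall i, f (free_gen F i) = c i.
Proof.
have [f [fc fM fE]] := free_hom_ex F (c : 'I_n -> Fp_group p) (Fp_pro_p p_pr).
by exists f => //; apply/H1_hom.
Qed.

Lemma free_H1_eq n (F : freeSigmaProP p n) (f g : F -> 'F_p) : H1 f -> H1 g ->
  (forall i, f (free_gen F i) = g (free_gen F i)) -> f = g.
Proof.
move=> fH gH fg; apply: (H1_eq p_pr (free_gen_topgen F) fH gH).
by move=> _ [i _ <-].
Qed.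

Lemma sigma_hom_minus (G H : sigmaGroupType) (f : G -> H) x :
  {morph f : x y / x * y} -> {morph f : x / sigma x} ->
  minus_part G x -> minus_part H (f x).
Proof. by move=> fM fs xm; rewrite /minus_part /= -fs xm (group_morphV fM). Qed.

End FreeGroups.

Lemma relators_closure_rel (G : sigmaGroupType) n (r : 'I_n -> minus_part G) i :
  relators_closure r (set_val (r i)).
Proof. by apply: sub_topgen; exists i, 1; rewrite conjg1. Qed.

Lemma relators_closure_min (G : sigmaGroupType) n (r : 'I_n -> minus_part G)
    (N : set G) :
  closed N -> is_normal N ->
  (forall i, N (set_val (r i))) -> relators_closure r `<=` N.
Proof. by move=> cN [sN NJ] Nr; apply: topgen_min => // _ [i [y ->]]; exact: NJ. Qed.

Lemma presented_hom (G G' : sigmaGroupType) (n : nat) (r : 'I_n -> minus_part G)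
    (N : sigmaNormal G') (u : G -> G') :
  continuous u -> {morph u : x y / x * y} -> {morph u : x / sigma x} ->
  (forall i, sn_set N (u (set_val (r i)))) ->
  exists v : presented r -> sigma_quot N,
    [/\ forall x, v (qproj _ x) = qproj _ (u x), continuous v,
      {morph v : x y / x * y} & {morph v : x / sigma x}].
Proof.
move=> uc uM us ur; apply: (@quot_factor _ _ _ (fun x => qproj N (u x))).
- by move=> x; apply: continuous_comp; [exact: uc|exact: qproj_continuous].
- by move=> x y; rewrite uM qprojM.
- by move=> x; rewrite us qproj_sigma.
- move=> x Nx; apply/qproj_eq1; move: x Nx; apply: relators_closure_min => //.
    by apply: preimage_closed => [x _|]; [exact: uc|exact: sn_closed].
  have [sN NJ] := sn_normal N; split; first exact: subgroup_preimage.
  by move=> x y Nx; rewrite /= /conjg !uM (group_morphV uM); exact: NJ.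
Qed.

(** As [u] and [v] have to be mutually inverse only modulo the relators, free groups of different
    ranks can be compared. *)
Lemma presented_iso (G G' : sigmaGroupType) (n n' : nat)
    (r : 'I_n -> minus_part G) (r' : 'I_n' -> minus_part G')
    (u : G -> G') (v : G' -> G) :
  continuous u -> {morph u : x y / x * y} -> {morph u : x / sigma x} ->
  continuous v -> {morph v : x y / x * y} -> {morph v : x / sigma x} ->
  (forall i, relators_closure r' (u (set_val (r i)))) ->
  (forall i, relators_closure r (v (set_val (r' i)))) ->
  (forall x, relators_closure r (x^-1 * v (u x))) ->
  (forall y, relators_closure r' (y^-1 * u (v y))) ->
  sigma_iso (presented r) (presented r').
Proof.
move=> uc uM us vc vM vs ur vr vu uv.
have [f [fE fc fM fs]] := @presented_hom _ _ _ r (relators_sub r') u uc uM us ur.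
have [g [gE gc gM gs]] := @presented_hom _ _ _ r' (relators_sub r) v vc vM vs vr.
exists f, g; split; split=> // q; have [x ->] := qproj_surj q.
  rewrite fE gE; apply/esym/qprojP; exact: vu.
rewrite gE fE; apply/esym/qprojP; exact: uv.
Qed.

Lemma image_subgroup (G H : topGroupType) (f : G -> H) :
  compact [set: G] -> hausdorff_space H -> continuous f -> {morph f : x y / x * y} ->
  closed (range f) /\ is_subgroup (range f).
Proof.
move=> cG hH fc fM; split; first by apply: compact_map_closed => //; exact: closedT.
split=> [|_ _ [x _ <-] [y _ <-]|_ [x _ <-]].
- by exists 1 => //; exact: group_morph1.
- by exists (x * y).
- by exists x^-1 => //; exact: group_morphV.
Qed.

(** * Change of basis in a free pro-p-group *)

Section FreeBasis.
Variables (p : nat) (p_pr : prime p) (n : nat) (F : freeSigmaProP p n).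

Let cF : compact [set: F]. Proof. by have [] := free_pro_p F. Qed.
Let hF : hausdorff_space F. Proof. by have [] := free_pro_p F. Qed.

(* The endomorphism phi sending the generators to y is onto by the Frattini argument,
   hence has a section psi. As H^1(F, F_p) is finite, phi acts bijectively on it, hence
   so does psi, and the Frattini argument shows that psi is onto too. *)
Lemma free_basis_change (y : 'I_n -> F) :
  (forall g : F -> 'F_p, H1 g -> (forall i, g (y i) = 0%R) -> forall x, g x = 0%R) ->
  exists phi psi : F -> F,
    [/\ continuous phi, {morph phi : x y / x * y}, continuous psi & {morph psi : x y / x * y}]
    /\ [/\ forall i, phi (free_gen F i) = y i, cancel phi psi & cancel psi phi].
Proof.
move=> yH.
have genY : topgen (range y) = setT.
  apply: contrapT => yT.
  have [cK sK] := topgen_closed_subgroup (range y).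
  have [f [fH fK [x]]] := pro_p_frattini p_pr (free_pro_p F) cK sK yT.
  by apply; apply: yH => // i; apply: fK; apply: sub_topgen; exists i.
have [phi [phic phiM phiE]] := free_hom_ex F y (free_pro_p F).
have phis x : exists z, phi z = x.
  have [cI sI] := image_subgroup cF hF phic phiM.
  have : topgen (range y) `<=` range phi.
    by apply: topgen_min => // _ [i _ <-]; exists (free_gen F i).
  by rewrite genY => /(_ x I) [z _ <-]; exists z.
have [psi [psic psiM psiE]] :=
  free_hom_ex F (fun i => sval (cid (phis (free_gen F i)))) (free_pro_p F).
have phipsi x : phi (psi x) = x.
  apply: (@free_hom_eq p p_pr n F F (fun x => phi (psi x)) id) => //.
  - by move=> z; apply: continuous_comp; [exact: psic|exact: phic].
  - by move=> a b; rewrite psiM phiM.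
  - by move=> z; exact: cvg_id.
  - by move=> i /=; rewrite psiE; case: cid.
have H1ex (c : {ffun 'I_n -> 'F_p}) :
    {f : F -> 'F_p | H1 f & forall i, f (free_gen F i) = c i}.
  exact: cid2 (free_H1_ex p_pr F c).
pose f_ c := s2val (H1ex c).
have f_H c : H1 (f_ c) := s2valP (H1ex c).
have f_E c i : f_ c (free_gen F i) = c i := s2valP' (H1ex c) i.
(* This is the pullback along [phi] on H^1, in the coordinates given by the values at the free
   generators. It is injective because [y] generates, hence bijective on a finite set. *)
pose Phi (c : {ffun 'I_n -> 'F_p}) := [ffun i => f_ c (y i)].
have Phi_inj : injective Phi.
  move=> c c' /ffunP cc'.
  have fcc' : f_ c = f_ c'.
    apply: (H1_eq p_pr genY) => // _ [i _ <-].
    by have := cc' i; rewrite !ffunE.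
  by apply/ffunP => i; rewrite -!f_E fcc'.
have [Phi' _ PhiK] := injF_bij Phi_inj.
have psis x : exists z, psi z = x.
  have [cI sI] := image_subgroup cF hF psic psiM.
  suff -> : (exists z, psi z = x) = range psi x.
    suff -> : range psi = setT by [].
    apply: contrapT => psiT.
    have [f [fH fK [z]]] := pro_p_frattini p_pr (free_pro_p F) cI sI psiT.
    (* Write [f] as [f_ c \o phi]. Since [phi \o psi] is the identity, [f_ c] equals [f \o psi],
       which is zero. *)
    apply; pose c := Phi' [ffun i => f (free_gen F i)].
    have fE : f = f_ c \o phi.
      apply: (free_H1_eq p_pr fH) => [|i]; first exact: H1_comp.
      have /ffunP/(_ i) := PhiK [ffun i => f (free_gen F i)].
      by rewrite !ffunE /= phiE.
    have fc0 x' : f_ c x' = 0%R.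
      by rewrite -[x']phipsi -[LHS]/((f_ c \o phi) (psi x')) -fE; apply: fK; exists x'.
    by rewrite fE /= fc0.
  by apply/propext; split=> [[z <-]|[z _ <-]]; exists z.
exists phi, psi; split; split=> // x; have [z <-] := psis x.
by rewrite phipsi.
Qed.

End FreeBasis.

Lemma minus_part_family (G : sigmaGroupType) n (g : 'I_n -> G) :
  (forall i, minus_part G (g i)) ->
  exists r : 'I_n -> minus_part G, forall i, set_val (r i) = g i.
Proof.
move=> gm.
have r_ex i : {x : minus_part G | set_val x = g i}.
  by exists (SigSub (mem_set (gm i))).
by exists (fun i => sval (r_ex i)) => i; case: (r_ex i).
Qed.

Lemma minus_part_val (G : sigmaGroupType) (x : minus_part G) : minus_part G (set_val x).
Proof. exact: set_valP. Qed.

(** * Changing the number of generators *)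

Section Stabilization.
Variables (p : nat) (p_pr : prime p) (F : forall n, freeSigmaProP p n).

Let hF n : hausdorff_space (F n). Proof. by have [] := free_pro_p (F n). Qed.

Lemma free_gen_minus n i : minus_part (F n) (free_gen (F n) i).
Proof. exact: free_sigma. Qed.

Lemma minus_part1 (G : sigmaGroupType) : minus_part G 1.
Proof. by rewrite /minus_part /= invg1 (group_morph1 sigmaM). Qed.

Lemma free_retract n (k : 'I_n.+1) : exists (u : F n -> F n.+1) (v : F n.+1 -> F n),
  [/\ [/\ continuous u, {morph u : x y / x * y} & {morph u : x / sigma x}],
      [/\ continuous v, {morph v : x y / x * y} & {morph v : x / sigma x}],
      forall i, u (free_gen (F n) i) = free_gen (F n.+1) (lift k i),
      v (free_gen (F n.+1) k) = 1 & cancel u v].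
Proof.
have [u [uc uM uE]] := free_hom_ex (F n) (fun i => free_gen (F n.+1) (lift k i)) (free_pro_p _).
have [v [vc vM vE]] := free_hom_ex (F n.+1)
  (fun i => if unlift k i is Some j then free_gen (F n) j else 1) (free_pro_p _).
exists u, v; split=> //.
- split=> //; apply: (free_hom_sigma p_pr) => // i; rewrite uE; exact: free_gen_minus.
- split=> //; apply: (free_hom_sigma p_pr) => // i; rewrite vE.
  by case: unlift => [j|]; [exact: free_gen_minus|exact: minus_part1].
- by rewrite vE unlift_none.
move=> x; apply: (@free_hom_eq p p_pr n (F n) (F n) (fun x => v (u x)) id) => //.
- exact: hF.
- by move=> z; apply: continuous_comp; [exact: uc|exact: vc].
- by move=> a b; rewrite uM vM.
- by move=> z; exact: cvg_id.
- by move=> i; rewrite uE vE liftK.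
Qed.

Lemma free_hom_mod n (N : sigmaNormal (F n)) (f : F n -> F n) :
  continuous f -> {morph f : x y / x * y} ->
  (forall i, sn_set N ((free_gen (F n) i)^-1 * f (free_gen (F n) i))) ->
  forall x, sn_set N (x^-1 * f x).
Proof.
move=> fc fM fN x; apply/qprojP; move: x.
apply: (@free_hom_eq p p_pr n (F n) (sigma_quot N) (qproj N) (fun x => qproj N (f x))).
- exact: quot_hausdorff.
- exact: qproj_continuous.
- exact: qprojM.
- by move=> x; apply: continuous_comp; [exact: fc|exact: qproj_continuous].
- by move=> x y; rewrite fM qprojM.
- by move=> i; apply/qprojP.
Qed.

Lemma presented_extend n (r : relators F n) :
  exists r' : relators F n.+1, sigma_iso (presented r) (presented r').
Proof.
have [u [v [[uc uM us] [vc vM vs] uE vk uvK]]] := free_retract (@ord_max n).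
have [|r' r'E] := @minus_part_family (F n.+1) n.+1 (fun i =>
    if unlift ord_max i is Some j then u (set_val (r j)) else free_gen (F n.+1) i).
  move=> i; case: unlift => [j|]; last exact: free_gen_minus.
  by apply: (sigma_hom_minus uM us); exact: minus_part_val.
exists r'; have [[N1 _ _] _] := relators_closure_normal r.
have [[N'1 _ _] _] := relators_closure_normal r'.
apply: (@presented_iso _ _ _ _ r r' u v) => //.
- by move=> i; have := @relators_closure_rel _ _ r' (lift ord_max i); rewrite r'E liftK.
- move=> i; rewrite r'E; case: unliftP => [j _|->]; last by rewrite vk.
  by rewrite uvK; exact: relators_closure_rel.
- by move=> x; rewrite uvK mulVg.
apply: (@free_hom_mod _ (relators_sub r') (fun y => u (v y))).
- by move=> z; apply: continuous_comp; [exact: vc|exact: uc].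
- by move=> a b; rewrite vM uM.
move=> i; case: (unliftP ord_max i) => [j ->|->].
  by rewrite -uE uvK mulVg.
rewrite vk (group_morph1 uM) mulg1; have [[_ _ NV] _] := relators_closure_normal r'.
apply: NV; have := @relators_closure_rel _ _ r' ord_max.
by rewrite r'E unlift_none.
Qed.

(* A relator which is nonzero in H_1(F, F_p) can be taken as a member of a new basis
   of F, and then be eliminated together with this generator. *)
Lemma presented_reduce n (r : relators F n.+1) (f : F n.+1 -> 'F_p) j :
  H1 f -> f (set_val (r j)) <> 0%R ->
  exists r' : relators F n, sigma_iso (presented r) (presented r').
Proof.
move=> fH frj.
(* The classes [d k] form the basis of H^1 dual to the free generators. *)
have H1ex k : {d : F n.+1 -> 'F_p | H1 d &
    forall i, d (free_gen (F n.+1) i) = (i == k)%:R%R}.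
  exact: cid2 (free_H1_ex p_pr (F n.+1) (fun i => (i == k)%:R%R)).
pose d k := s2val (H1ex k).
have dH k : H1 (d k) := s2valP (H1ex k).
have dE k i : d k (free_gen (F n.+1) i) = (i == k)%:R%R := s2valP' (H1ex k) i.
have gE (g : F n.+1 -> 'F_p) : H1 g ->
    g = fun x => (\sum_(k < n.+1) g (free_gen (F n.+1) k) * d k x)%R.
  move=> gH; apply: (free_H1_eq p_pr gH); first exact: H1_lin.
  move=> i; rewrite (bigD1 i) //= dE eqxx GRing.mulr1 big1 ?GRing.addr0 // => k ki.
  by rewrite dE eq_sym (negPf ki) GRing.mulr0.
have [k dk] : exists k, d k (set_val (r j)) <> 0%R.
  apply/existsNP => d0; apply: frj; rewrite (gE f fH) big1 // => k _.
  by rewrite d0 GRing.mulr0.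
(* Exchange step: a class vanishing on all generators but the [k]-th is a multiple of [d k], and
   [d k] does not vanish on the relator put in place of that generator. *)
have [|phi [psi [[phic phiM psic psiM] [phiE phiK psiK]]]] := @free_basis_change p p_pr _
    (F n.+1) (fun i => if i == k then set_val (r j) else free_gen (F n.+1) i).
  move=> g gH g0 x; have gi i : i != k -> g (free_gen (F n.+1) i) = 0%R.
    by move=> ik; have := g0 i; rewrite (negPf ik).
  have gsum z : g z = (g (free_gen (F n.+1) k) * d k z)%R.
    rewrite {1}(gE g gH) (bigD1 k) //= big1 ?GRing.addr0 // => i ik.
    by rewrite gi // GRing.mul0r.
  have := g0 k; rewrite eqxx gsum => /eqP; rewrite GRing.mulf_eq0 => /orP[/eqP gk|/eqP //].
  by rewrite gsum gk GRing.mul0r.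
(* Equivariance needs the new basis element to be inverted by [sigma]; this holds because relators
   lie in the minus part. *)
have phis : {morph phi : x / sigma x}.
  apply: (free_hom_sigma p_pr) => // i; rewrite phiE; case: eqP => _.
    exact: minus_part_val.
  exact: free_gen_minus.
have psis : {morph psi : x / sigma x} by move=> x; apply: (can_inj phiK); rewrite psiK phis psiK.
have [v [u0 [[vc vM vs] [u0c u0M u0s] vE u0k vu0K]]] := free_retract k.
(* [psi] rewrites [x] in the new basis, and [u0] then kills the [k]-th basis element, which is the
   relator. *)
pose u x := u0 (psi x).
have uc : continuous u by move=> x; apply: continuous_comp; [exact: psic|exact: u0c].
have uM : {morph u : x y / x * y} by move=> x y; rewrite /u psiM u0M.
have us : {morph u : x / sigma x} by move=> x; rewrite /u psis u0s.
have phiv x : phi (v x) = v x.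
  apply: (@free_hom_eq p p_pr n (F n) (F n.+1) (fun x => phi (v x)) v) => //.
  - exact: hF.
  - by move=> z; apply: continuous_comp; [exact: vc|exact: phic].
  - by move=> a b; rewrite vM phiM.
  - by move=> i; rewrite vE phiE eq_sym (negPf (neq_lift k i)).
have psiv x : psi (v x) = v x by rewrite -{1}phiv phiK.
have uv : cancel v u by move=> x; rewrite /u psiv vu0K.
have urj : u (set_val (r j)) = 1.
  have := phiE k; rewrite eqxx => <-; by rewrite /u phiK.
(* The map [v \o u] sends the relator to 1 and fixes the other members of the new basis, so it is
   the identity modulo the relators. *)
have vu : forall x, relators_closure r (x^-1 * v (u x)).
  move=> x; rewrite -[x]psiK; move: (psi x) => {}x; rewrite /u phiK.
  apply/(@qprojP _ (relators_sub r)); move: x.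
  apply: (@free_hom_eq p p_pr _ (F n.+1) (presented r)
    (fun x => qproj _ (phi x)) (fun x => qproj _ (v (u0 x)))).
  - exact: quot_hausdorff.
  - by move=> x; apply: continuous_comp; [exact: phic|exact: qproj_continuous].
  - by move=> x y; rewrite phiM qprojM.
  - move=> x; apply: (@continuous_comp _ _ _ u0 (fun y => qproj _ (v y))); first exact: u0c.
    by apply: continuous_comp; [exact: vc|exact: qproj_continuous].
  - by move=> x y; rewrite u0M vM qprojM.
  move=> i; case: (unliftP k i) => [i' ->|->]; apply/qprojP.
    rewrite phiE eq_sym (negPf (neq_lift k i')) -vE vu0K mulVg.
    by case: (relators_closure_normal r) => -[].
  rewrite phiE eqxx u0k (group_morph1 vM) mulg1.
  by have [[_ _ NV] _] := relators_closure_normal r; apply: NV; exact: relators_closure_rel.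
(* Relator [j] has become trivial under [u]; the images of the other [n] relators remain. *)
have [|r' r'E] := @minus_part_family (F n) n (fun i => u (set_val (r (lift j i)))).
  by move=> i; apply: (sigma_hom_minus uM us); exact: minus_part_val.
exists r'; have [[N1 NM NV] _] := relators_closure_normal r.
have [[N'1 _ _] _] := relators_closure_normal r'.
apply: (@presented_iso _ _ _ _ r r' u v) => //.
- move=> i; case: (unliftP j i) => [i' ->|->]; last by rewrite urj.
  by rewrite -r'E; exact: relators_closure_rel.
- move=> i; rewrite r'E; set x := set_val _.
  by rewrite -[v _](mulKVg x); apply: (NM) => //; exact: relators_closure_rel.
- by move=> y; rewrite uv mulVg.
Qed.

End Stabilization.

(** * Generator rank *)

Section GeneratorRank.
Variables (p : nat) (p_pr : prime p).

Lemma H1_quot_factor (G : sigmaGroupType) (N : sigmaNormal G) (f : G -> 'F_p) :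
  H1 f -> (forall x, sn_set N x -> f x = 0%R) ->
  exists2 g : sigma_quot N -> 'F_p, H1 g & f = g \o qproj N.
Proof.
move=> fH fN; have /H1_hom[fc fM] := fH.
pose g (q : sigma_quot N) := f (sval (cid (qproj_surj q))).
have gE x : g (qproj N x) = f x.
  rewrite /g; case: cid => y /= /esym/qprojP Nyx.
  by apply/(H1_mulV _ _ fH); exact: fN.
have fg : f = g \o qproj N by apply/funext => x; rewrite /= gE.
exists g => //; apply/H1_hom; split.
  by apply/quotient_continuous; rewrite -/(g \o qproj N) -fg.
move=> q1 q2; have [x ->] := @qproj_surj _ N q1; have [y ->] := @qproj_surj _ N q2.
by rewrite -qprojM !gE; exact: fM.
Qed.

(** The pullback along [u] identifies H^1 of [Q] with H^1 of [G], injectively since [u] is onto;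
    bases are carried across in both directions. *)
Lemma has_gen_rank_surj (G Q : topGroupType) (u : G -> Q) d :
  continuous u -> {morph u : x y / x * y} -> (forall y, exists x, u x = y) ->
  (forall f : G -> 'F_p, H1 f -> exists2 g : Q -> 'F_p, H1 g & f = g \o u) ->
  has_gen_rank p G d <-> has_gen_rank p Q d.
Proof.
move=> uc uM us uf.
have u_inj (f g : Q -> 'F_p) : f \o u = g \o u -> f = g.
  by move=> fg; apply/funext => y; have [x <-] := us y; exact: (congr1 (@^~ x) fg).
split=> -[b [bH bU]].
  have b'_ex i : {b' : Q -> 'F_p | H1 b' & b i = b' \o u} by apply: cid2; exact: uf.
  pose b' i := s2val (b'_ex i).
  have b'E i : b i = b' i \o u := s2valP' (b'_ex i).
  have sumE (c : {ffun 'I_d -> 'F_p}) : (fun x => \sum_(i < d) c i * b i x)%R =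
      (fun y => \sum_(i < d) c i * b' i y)%R \o u.
    by apply/funext => x /=; apply: eq_bigr => i _; rewrite b'E.
  exists b'; split=> [i|f fH]; first exact: s2valP (b'_ex i).
  have [c [cE cU]] := bU _ (H1_comp uc uM fH).
  exists c; split=> [|c' c'E]; first by apply: u_inj; rewrite cE sumE.
  by apply: cU; rewrite sumE c'E.
exists (fun i => b i \o u); split=> [i|f /uf[g gH ->]]; first exact: H1_comp.
have [c [cE cU]] := bU _ gH; exists c; split=> [|c' c'E]; first by rewrite {1}cE.
by apply: cU; apply: u_inj; rewrite c'E.
Qed.

Lemma has_gen_rank_iso (G H : sigmaGroupType) d : sigma_iso G H ->
  has_gen_rank p G d <-> has_gen_rank p H d.
Proof.
move=> [f [g [[fK gK fc gc] [fM _]]]]; apply: (@has_gen_rank_surj G H f d fc fM).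
  by move=> y; exists (g y).
move=> h hH; exists (h \o g); last by apply/funext => x /=; rewrite fK.
by apply: H1_comp => // x y; apply: (can_inj fK); rewrite fM !gK.
Qed.

Lemma has_gen_rank_zassenhaus2 (G : sigmaGroupType) d :
  has_gen_rank p G d <-> has_gen_rank p (zassenhaus_quot p G 2) d.
Proof.
apply: (@has_gen_rank_surj _ _ (qproj (zassenhaus_sub p G 2))).
- exact: qproj_continuous.
- exact: qprojM.
- by move=> q; have [x ->] := qproj_surj q; exists x.
- move=> f fH; apply: H1_quot_factor => //; exact: H1_zassenhaus2.
Qed.

(** Evaluation at the generators embeds H^1 into [F_p^n]. The rows of [A] list all vectors of the
    image, and a row basis of [A], of size at most [n], is pulled back to H^1. *)
Lemma has_gen_rank_ex (G : topGroupType) n (y : 'I_n -> G) :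
  topgen (range y) = setT -> exists2 d, has_gen_rank p G d & d <= n.
Proof.
move=> genY.
pose V (v : 'rV['F_p]_n) := exists2 f : G -> 'F_p, H1 f & forall i, f (y i) = v 0%R i.
pose W : {set 'rV['F_p]_n} := [set v | `[< V v >]]%SET.
have WP v : reflect (V v) (v \in W) by rewrite inE; exact: asboolP.
pose A : 'M['F_p]_(#|W|, n) := (\matrix_(i < #|W|) (enum_val i))%R.
have VA v : V v -> (v <= A)%MS.
  move=> /WP Wv; apply: submx_trans (row_sub (enum_rank_in Wv v) A).
  by rewrite rowK enum_rankK_in.
have AV v : (v <= A)%MS -> V v.
  move=> /submxP[D ->]; have VW i : V (row i A) by rewrite rowK; apply/WP; exact: enum_valP.
  exists (fun x => \sum_i D 0%R i * s2val (cid2 (VW i)) x)%R.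
    by apply: H1_lin => i; exact: s2valP (cid2 (VW i)).
  move=> i; rewrite mxE; apply: eq_bigr => k _.
  by rewrite (s2valP' (cid2 (VW k)) i) mxE.
have rbV i : V (row i (row_base A)).
  by apply: AV; apply: submx_trans (row_sub i _) _; rewrite eq_row_base.
pose b i := s2val (cid2 (rbV i)).
have bH i : H1 (b i) := s2valP (cid2 (rbV i)).
have bE i j : b i (y j) = row_base A i j.
  by rewrite /b (s2valP' (cid2 (rbV i)) j) mxE.
have sumE (c : {ffun 'I_(\rank A) -> 'F_p}) j :
    (\sum_i c i * b i (y j) = ((\row_i c i) *m row_base A) 0 j)%R.
  by rewrite mxE; apply: eq_bigr => i _; rewrite mxE bE.
exists (\rank A); last exact: rank_leq_col.
exists b; split=> // f fH.
have : (((\row_j f (y j))%R : 'rV['F_p]_n) <= row_base A)%MS.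
  by rewrite eq_row_base; apply: VA; exists f => // i; rewrite mxE.
move=> /submxP[D DE]; exists [ffun i => D 0%R i].
have DE' : (\row_i [ffun i => D 0%R i] i)%R = D :> 'rV['F_p]_(\rank A).
  by apply/rowP => i; rewrite mxE ffunE.
split.
  apply: (H1_eq p_pr genY fH); first exact: H1_lin.
  by move=> _ [j _ <-]; rewrite sumE DE' -DE mxE.
move=> c' fc'; apply/ffunP => i; rewrite ffunE.
have : (D *m row_base A = (\row_i c' i) *m row_base A)%R.
  by rewrite -DE; apply/rowP => j; rewrite mxE fc' sumE.
by move=> /(row_free_inj (row_base_free A)) ->; rewrite mxE.
Qed.

(** If all classes of [F_n] vanished on the relators, they would factor through [G_r], and their
    [p^n] value vectors on the generators would inject into the [p^d] coordinate vectors of H^1 of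
    [G_r]. *)
Lemma gen_rank_relator (F : forall n, freeSigmaProP p n) n (r : relators F n) d :
  has_gen_rank p (presented r) d -> d < n ->
  exists j, exists2 f : F n -> 'F_p, H1 f & f (set_val (r j)) <> 0%R.
Proof.
move=> [b [bH bU]] dn; apply: contrapT => noj.
have fr0 (f : F n -> 'F_p) j : H1 f -> f (set_val (r j)) = 0%R.
  by move=> fH; apply: contrapT => frj; apply: noj; exists j, f.
have lift_ex (c : {ffun 'I_n -> 'F_p}) : {e : {ffun 'I_d -> 'F_p} |
    forall i, (\sum_(k < d) e k * b k (qproj (relators_sub r) (free_gen (F n) i)))%R = c i}.
  apply: cid; have [f fH fE] := free_H1_ex p_pr (F n) c.
  have [cK sK] := H1_ker p_pr fH.
  have [|g gH fg] := @H1_quot_factor _ (relators_sub r) f fH.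
    apply: relators_closure_min => //; last by move=> i; exact: fr0.
    split=> // x y /= fx; have [fM _] := fH.
    rewrite /conjg fM fM fx GRing.add0r -fM mulVg.
    by have [_ fM'] := (H1_hom f).1 fH; exact: (group_morph1 fM').
  have [c' [gE _]] := bU g gH; exists c' => i.
  by rewrite -fE fg /= gE.
pose e c := sval (lift_ex c).
have eE c i : (\sum_(k < d) e c k * b k (qproj (relators_sub r) (free_gen (F n) i)))%R = c i.
  by rewrite /e; case: (lift_ex c).
have e_inj : injective e by move=> c c' cc'; apply/ffunP => i; rewrite -!eE cc'.
have := leq_card e e_inj; rewrite !card_ffun !card_ord leq_exp2l.
  by rewrite leqNgt dn.
by rewrite (Fp_cast p_pr) prime_gt1.
Qed.

End GeneratorRank.

(** * The space of weak Schur groups *)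

Lemma topgen_surj (G H : topGroupType) n (q : G -> H) (y : 'I_n -> G) :
  continuous q -> {morph q : x y / x * y} -> (forall z, exists x, q x = z) ->
  topgen (range y) = setT -> topgen (range (q \o y)) = setT.
Proof.
move=> qc qM qs genY; apply/seteqP; split=> // z _; have [x <-] := qs z.
have : topgen (range y) x by rewrite genY.
move: x; apply: topgen_morph => // _ [i _ <-]; apply: sub_topgen; exists i => //.
Qed.

Lemma zassenhaus_open_range (p : nat) (G : topGroupType) n (y : 'I_n -> G) i :
  1 < p -> topgen (range y) = setT -> 0 < i -> open (zassenhaus p G i).
Proof.
move=> p1 genY; apply: (@zassenhaus_open _ _ (codom y)) => //; rewrite -genY.
congr topgen; apply/seteqP; split=> x /=.
  by move=> /codomP[j ->]; exists j.
by move=> [j _ <-]; exact: codom_f.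
Qed.

Lemma compact_cluster_seq (T : topologicalType) (u : nat -> T) :
  compact [set: T] ->
  exists x : T, forall (U : set T) k, nbhs x U -> exists2 j, k <= j & U (u j).
Proof.
move=> cT; have [|x [_ xu]] := cT (fmap u eventually) _; first exact: filterT.
exists x => U k xU; have [|y [[j kj <-] Uy]] := xu [set u j | j in [set j | k <= j]] U _ xU.
  by exists k => // j kj; exists j.
by exists j.
Qed.

Lemma minus_part_compact (G : sigmaGroupType) :
  compact [set: G] -> hausdorff_space G -> compact [set: minus_part G].
Proof.
move=> cG hG; have cm : closed (minus_part G).
  apply: closed_group_eq => //; first exact: sigma_continuous.
  exact: invg_continuous.
have cpm := subclosed_compact cm cG (@subsetT _ _).
move=> E PE _; have [|x [xm xE]] := cpm (set_val @ E) _.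
  apply: (@filterS _ E _ setT); last exact: filterT.
  by move=> x _; exact: set_valP.
have [y yx] : exists y : minus_part G, set_val y = x by exists (SigSub (mem_set xm)).
exists y; split=> // A B EA [_ [[O oO <-]] Oy OB].
have EA' : E (set_val @^-1` (set_val @` A)) by apply: filterS EA => z Az; exists z.
have xO : nbhs x O by apply: open_nbhs_nbhs; split=> //; rewrite -yx.
have [_ [[z Az <-] Oz]] := xE _ _ EA' xO.
by exists z; split=> //; apply: OB.
Qed.

Section WeakSchur.
Variables (p : nat) (p_pr : prime p) (F : forall n, freeSigmaProP p n).

Let p1 : 1 < p := prime_gt1 p_pr.

Local Notation proj r := (qproj (relators_sub r)).

Lemma presented_gen n (r : relators F n) :
  topgen (range (proj r \o free_gen (F n))) = setT.
Proof.
apply: topgen_surj; [exact: qproj_continuous|exact: qprojM| |exact: free_gen_topgen].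
by move=> q; have [x ->] := qproj_surj q; exists x.
Qed.

Lemma presented_zassenhaus_open n (r : relators F n) i :
  0 < i -> open (zassenhaus p (presented r) i).
Proof. exact: zassenhaus_open_range p1 (presented_gen r). Qed.

Lemma presented_zassenhausP n (r : relators F n) i x : 0 < i ->
  zassenhaus p (presented r) i (proj r x) <->
  exists2 z, zassenhaus p (F n) i z & relators_closure r (z^-1 * x).
Proof.
move=> i0; split=> [Dx|[z Dz zx]]; last first.
  have <- : proj r z = proj r x by apply/qprojP.
  by apply: zassenhaus_morph Dz; [exact: qprojM|exact: qproj_continuous].
have [cF _ _ _] := free_pro_p (F n).
have [|||z Dz /qprojP zx] := zassenhaus_surj_image p1 cF _ (@qprojM _ (relators_sub r)) _ _ i0 Dx.
- exact: quot_hausdorff.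
- exact: qproj_continuous.
- by move=> q; have [y ->] := qproj_surj q; exists y.
by exists z.
Qed.

(** The preimage of [D_i(G_r)] in [F_n] is a closed normal subgroup containing [D_i(F_n)] and the
    relators [r]; hence it contains the relators [r'] and their normal closure. *)
Lemma presented_zassenhaus_sub n (r r' : relators F n) i x : 0 < i ->
  (forall j, zassenhaus p (F n) i ((set_val (r j))^-1 * set_val (r' j))) ->
  zassenhaus p (presented r') i (proj r' x) -> zassenhaus p (presented r) i (proj r x).
Proof.
move=> i0 rr' /presented_zassenhausP - /(_ i0) [z Dz Nzx].
have [[D1 DM DV] DJ] := zassenhaus_normal p (presented r) i.
have DF y : zassenhaus p (F n) i y -> zassenhaus p (presented r) i (proj r y).
  by apply: zassenhaus_morph; [exact: qprojM|exact: qproj_continuous].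
rewrite -(mulKVg z x) qprojM; apply: (DM); first exact: DF.
move: (z^-1 * x) Nzx; apply: relators_closure_min.
- apply: preimage_closed => [y _|]; first exact: qproj_continuous.
  by case: (zassenhaus_closed_subgroup p (presented r) i).
- by apply: qproj_preimage_normal.
move=> j; rewrite /= -(mulKVg (set_val (r j)) (set_val (r' j))) qprojM.
rewrite (qproj_eq1 (relators_sub r) (set_val (r j))).2 ?mul1g; first exact: DF.
exact: relators_closure_rel.
Qed.

Lemma zassenhaus_quot_presented n (r r' : relators F n) i : 0 < i ->
  (forall j, zassenhaus p (F n) i ((set_val (r j))^-1 * set_val (r' j))) ->
  sigma_iso (zassenhaus_quot p (presented r') i) (zassenhaus_quot p (presented r) i).
Proof.
move=> i0 rr'; have [cF _ _ _] := free_pro_p (F n).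
have [_ [_ _ DV]] := zassenhaus_closed_subgroup p (F n) i.
have r'r j : zassenhaus p (F n) i ((set_val (r' j))^-1 * set_val (r j)).
  by rewrite -[X in zassenhaus _ _ _ X]invgK invgM invgK; exact: DV.
pose f (s : relators F n) (x : F n) : zassenhaus_quot p (presented s) i :=
  qproj (zassenhaus_sub p (presented s) i) (proj s x).
have fc (s : relators F n) : continuous (f s).
  by move=> x; apply: continuous_comp; exact: qproj_continuous.
have fM (s : relators F n) : {morph f s : x y / x * y} by move=> x y; rewrite /f !qprojM.
have fs (s : relators F n) : {morph f s : x / sigma x} by move=> x; rewrite /f !qproj_sigma.
have fsurj (s : relators F n) q : exists x, f s x = q.
  have [y ->] := qproj_surj q; have [x ->] := qproj_surj y; by exists x.
apply: (@sigma_iso_of_ker (F n) _ _ (f r') (f r)) => //; try exact: quot_hausdorff.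
by move=> x; split=> /qproj_eq1 Dx; apply/qproj_eq1;
  [exact: presented_zassenhaus_sub Dx|exact: presented_zassenhaus_sub Dx].
Qed.

Lemma Theta_continuous n : continuous (Theta p_pr F n).
Proof.
move=> r A /(sch_basisP p_pr F).2 [_ [[i [G [i2 ->]]] /sch_nbhsP rG UA]].
have i0 : 0 < i := ltnW i2.
have Dr : \forall r' \near r,
    forall j, zassenhaus p (F n) i ((set_val (r j))^-1 * set_val (r' j)).
  apply: (@filter_forall _ _ (fun j (r' : relators F n) =>
    zassenhaus p (F n) i ((set_val (r j))^-1 * set_val (r' j))) (nbhs r)) => j.
  have : continuous (fun r' : relators F n => (set_val (r j))^-1 * set_val (r' j)).
    move=> r'; apply: (@continuous_comp _ (minus_part (F n)) _ (fun r' : relators F n => r' j)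
      (fun x => (set_val (r j))^-1 * set_val x)); first exact: proj_continuous.
    apply: (@continuous_comp _ _ _ set_val (fun x => (set_val (r j))^-1 * x)).
      exact: initial_continuous.
    exact: mulgl_continuous.
  apply; apply: open_nbhs_nbhs; split; last first.
    by rewrite mulVg; case: (zassenhaus_closed_subgroup p (F n) i) => _ [].
  exact: (zassenhaus_open_range p1 (free_gen_topgen p_pr (F n))).
apply: filterS Dr => r' rr'; apply: UA; apply/sch_nbhsP.
exact: sigma_iso_trans (zassenhaus_quot_presented i0 rr') rG.
Qed.

Lemma relators_compact n : compact [set: relators F n].
Proof.
have [cF hF _ _] := free_pro_p (F n).
have := @tychonoff 'I_n (fun=> minus_part (F n)) (fun=> setT)
  (fun=> minus_part_compact cF hF).
by congr (compact _); apply/seteqP; split.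
Qed.

End WeakSchur.

(** * Separation of weak Schur groups by their Zassenhaus quotients *)

Section Separation.
Variables (p : nat) (p_pr : prime p) (F : forall n, freeSigmaProP p n).

Let p1 : 1 < p := prime_gt1 p_pr.

Local Notation proj r := (qproj (relators_sub r)).

Section ApproximateIso.
Variables (G : sigmaGroupType) (H : sigmaGroupType).
Variables (A : sigmaGroupType) (u : A -> G).
Hypotheses (cA : compact [set: A]) (hG : hausdorff_space G).
Hypotheses (uc : continuous u) (uM : {morph u : x y / x * y}).
Hypothesis (us : forall y, exists x, u x = y).

(* f induces a sigma-isomorphism from G / D_i(G) to H / D_i(H). *)
Definition approx_iso i (f : A -> H) : Prop :=
  [/\ forall x, zassenhaus p G i (u x) <-> zassenhaus p H i (f x),
      forall y, exists x, zassenhaus p H i (y^-1 * f x)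
    & forall x, zassenhaus p H i ((sigma (f x))^-1 * f (sigma x))].

(** The equivalence of memberships is not a mere weakening of the one at [j]. An element of [D_i]
    has to be lifted to [D_i(A)], along [u] onto [G] in one direction and along the map induced by
    [f] onto [H / D_j(H)] in the other; the error then lies in [D_j]. *)
Lemma approx_iso_le i j (f : A -> H) :
  continuous f -> {morph f : x y / x * y} -> 0 < i -> i <= j ->
  approx_iso j f -> approx_iso i f.
Proof.
move=> fc fM i0 ij [fD fsurj fsig].
have Gle := @zassenhaus_le p G _ _ p1 i0 ij; have Hle := @zassenhaus_le p H _ _ p1 i0 ij.
have [_ [_ GM _]] := zassenhaus_closed_subgroup p G i.
have [_ [_ HM _]] := zassenhaus_closed_subgroup p H i.
split=> [x|y|x]; last 2 first.
- by have [x yx] := fsurj y; exists x; exact: Hle.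
- exact: Hle.
split=> [Dux|Dfx].
  have [z Dz zx] := zassenhaus_surj_image p1 cA hG uM uc us i0 Dux.
  rewrite -(mulKVg z x) fM; apply: HM; first exact: zassenhaus_morph Dz.
  apply: Hle; apply/fD; rewrite uM (group_morphV uM) zx mulVg.
  by have [_ []] := zassenhaus_closed_subgroup p G j.
pose q x : zassenhaus_quot p H j := qproj (zassenhaus_sub p H j) (f x).
have qc : continuous q by move=> y; apply: continuous_comp; [exact: fc|exact: qproj_continuous].
have qM : {morph q : x y / x * y} by move=> y z; rewrite /q fM qprojM.
have qs y : exists x, q x = y.
  by have [z ->] := qproj_surj y; have [t zt] := fsurj z; exists t; apply/esym/qprojP.
have Dq : zassenhaus p (zassenhaus_quot p H j) i (q x).
  by apply: zassenhaus_morph Dfx; [exact: qprojM|exact: qproj_continuous].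
have [|z Dz /qprojP zx] := zassenhaus_surj_image p1 cA _ qM qc qs i0 Dq.
  exact: quot_hausdorff.
rewrite -(mulKVg z x) uM; apply: GM; first exact: zassenhaus_morph Dz.
by apply: Gle; apply/fD; rewrite fM (group_morphV fM).
Qed.

(** All three conditions see [f] only modulo [D_i(H)], so they pass to any map close enough to
    [f]. *)
Lemma approx_iso_eq i (f g : A -> H) :
  (forall x, zassenhaus p H i ((f x)^-1 * g x)) -> approx_iso i f -> approx_iso i g.
Proof.
move=> fg [fD fsurj fsig]; have [[D1 DM DV] DJ] := zassenhaus_normal p H i.
split=> [x|y|x].
- split=> [/fD Dfx|Dgx]; first by rewrite -(mulKVg (f x) (g x)); apply: DM.
  apply/fD; rewrite -[f x](mulgK ((f x)^-1 * g x)) mulKVg.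
  by apply: DM => //; apply: DV.
- have [x yx] := fsurj y; exists x.
  by rewrite -(mulKVg (f x) (g x)) mulgA; apply: DM.
- have -> : (sigma (g x))^-1 * g (sigma x) = (sigma ((f x)^-1 * g x))^-1 *
      ((sigma (f x))^-1 * f (sigma x)) * ((f (sigma x))^-1 * g (sigma x)).
    by rewrite sigmaM (morphV_of sigmaM) invgM invgK !mulgA !mulgK.
  apply: (DM) => //; apply: (DM) => //; apply: DV; exact: zassenhaus_sigma.
Qed.

End ApproximateIso.

Lemma presented_separated n m (r : relators F n) (s : relators F m) :
  (forall i, 2 <= i -> sigma_iso (zassenhaus_quot p (presented r) i)
                                 (zassenhaus_quot p (presented s) i)) ->
  sigma_iso (presented r) (presented s).
Proof.
move=> iso_i; set G := presented r; set H := presented s.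
have [cF _ _ _] := free_pro_p (F n).
have pG : pro_p p G := presented_pro_p r; have pH : pro_p p H := presented_pro_p s.
have [_ hG _ _] := pG; have [cH hH _ _] := pH.
have rsurj (y : G) : exists x, proj r x = y by have [x ->] := qproj_surj y; exists x.
(* The shift to [i.+2] matches the range [2 <= i] of the hypothesis. Representatives in [H] of the
   images of the generators define the lift. *)
have approx_ex i : exists f : F n -> H, [/\ continuous f, {morph f : x y / x * y} &
    approx_iso (proj r) i.+2 f].
  have [e [e' [[eK e'K ec e'c] [eM es]]]] := iso_i i.+2 isT.
  have hh j : exists h : H, qproj (zassenhaus_sub p H i.+2) h =
      e (qproj (zassenhaus_sub p G i.+2) (proj r (free_gen (F n) j))).
    by have [h ->] := qproj_surj (e (qproj _ (proj r (free_gen (F n) j)))); exists h.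
  have [f [fc fM fE]] := free_hom_ex (F n) (fun j => sval (cid (hh j))) pH.
  have feE x : qproj (zassenhaus_sub p H i.+2) (f x) =
      e (qproj (zassenhaus_sub p G i.+2) (proj r x)).
    move: x; apply: (@free_hom_eq p p_pr n (F n) (zassenhaus_quot p H i.+2)
      (fun x => qproj _ (f x)) (fun x => e (qproj _ (proj r x)))).
    - exact: quot_hausdorff.
    - by move=> x; apply: continuous_comp; [exact: fc|exact: qproj_continuous].
    - by move=> x y; rewrite fM qprojM.
    - move=> x; apply: (@continuous_comp _ _ _ (fun x => qproj _ (proj r x)) e); last exact: ec.
      by apply: continuous_comp; exact: qproj_continuous.
    - by move=> x y; rewrite !qprojM eM.
    - by move=> j; rewrite fE; case: cid.
  exists f; split=> //; split=> [x|y|x].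
  - split=> [/(@qproj_eq1 _ (zassenhaus_sub p G i.+2)) Dx|
            /(@qproj_eq1 _ (zassenhaus_sub p H i.+2)) Dx].
      apply/(@qproj_eq1 _ (zassenhaus_sub p H i.+2)).
      by rewrite feE Dx (group_morph1 eM).
    apply/(@qproj_eq1 _ (zassenhaus_sub p G i.+2)); apply: (can_inj eK).
    by rewrite -feE Dx (group_morph1 eM).
  - have [g gy] := qproj_surj (e' (qproj (zassenhaus_sub p H i.+2) y)).
    have [x xg] := rsurj g; exists x.
    by apply/(@qprojP _ (zassenhaus_sub p H i.+2)); rewrite feE xg -gy e'K.
  - apply/(@qprojP _ (zassenhaus_sub p H i.+2)).
    by rewrite qproj_sigma !feE !qproj_sigma es.
pose f_ i := sval (cid (approx_ex i)).
have f_P i : [/\ continuous (f_ i), {morph f_ i : x y / x * y} & approx_iso (proj r) i.+2 (f_ i)].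
  exact: svalP (cid (approx_ex i)).
have cHn : compact [set: {ptws 'I_n -> H}].
  have := @tychonoff 'I_n (fun=> H) (fun=> setT) (fun=> cH).
  by congr (compact _); apply/seteqP; split.
have [h hP] := @compact_cluster_seq {ptws 'I_n -> H} (fun k j => f_ k (free_gen (F n) j)) cHn.
have [f [fc fM fE]] := free_hom_ex (F n) h pH.
(* Since [D_(i+2)(H)] is open, the cluster point agrees modulo it with some [f_ k], and [k] can be
   taken at least [i], so that [f_ k] is accurate enough. *)
have fapp i : approx_iso (proj r) i.+2 f.
  have [[D1 DM DV] DJ] := zassenhaus_normal p H i.+2.
  have Dh : \forall h' \near h, forall j, zassenhaus p H i.+2 ((h j)^-1 * h' j).
    apply: (@filter_forall _ _ (fun j (h' : {ptws 'I_n -> H}) =>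
      zassenhaus p H i.+2 ((h j)^-1 * h' j)) (nbhs h)) => j.
    have : continuous (fun h' : {ptws 'I_n -> H} => (h j)^-1 * h' j).
      move=> h'; apply: (@continuous_comp _ H _ (fun h' : {ptws 'I_n -> H} => h' j)
        (fun x => (h j)^-1 * x)); first exact: proj_continuous.
      exact: mulgl_continuous.
    apply; apply: open_nbhs_nbhs; split; last by rewrite mulVg.
    exact: (@presented_zassenhaus_open p p_pr F m s i.+2).
  have [k ik hk] := hP _ i Dh; have [fkc fkM fkapp] := f_P k.
  apply: (@approx_iso_eq _ _ _ _ i.+2 (f_ k)); last first.
    exact: (@approx_iso_le G H (F n) (proj r) cF hG (@qproj_continuous _ _) (@qprojM _ _)
      rsurj i.+2 k.+2 (f_ k) fkc fkM isT ik fkapp).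
  move=> x; apply/(@qprojP _ (zassenhaus_sub p H i.+2)); move: x.
  apply: (@free_hom_eq p p_pr n (F n) (zassenhaus_quot p H i.+2)
      (fun x => qproj _ (f_ k x)) (fun x => qproj _ (f x))).
  - exact: quot_hausdorff.
  - by move=> x; apply: continuous_comp; [exact: fkc|exact: qproj_continuous].
  - by move=> x y; rewrite fkM qprojM.
  - by move=> x; apply: continuous_comp; [exact: fc|exact: qproj_continuous].
  - by move=> x y; rewrite fM qprojM.
  - by move=> j; rewrite fE; apply/esym/(@qprojP _ (zassenhaus_sub p H i.+2)); exact: hk.
have D2 (K : sigmaGroupType) (x : K) : pro_p p K ->
    (forall i, zassenhaus p K i.+2 x) -> x = 1.
  move=> pK Dx; apply: (zassenhaus_cap p_pr pK) => i i0.
  by apply: (@zassenhaus_le p K i i.+2 p1 i0) => //; exact: leq_trans (leqnSn _) (leqnSn _).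
(* Valid modulo every [D_i], the approximate statements become exact because the intersection of the
   [D_i] is trivial. For surjectivity, the image of [f] is closed and meets every coset
   [y D_i(H)]. *)
apply: (@sigma_iso_of_ker (F n) G H (proj r) f) => //.
- exact: qproj_continuous.
- exact: qprojM.
- exact: qproj_sigma.
- move=> x; apply: (@mulgI _ (sigma (f x))^-1); rewrite mulVg; apply: D2 => // i.
  by have [_ _] := fapp i; exact.
- move=> y; have [cI sI] := image_subgroup cF hH fc fM.
  apply: contrapT => yI.
  have : nbhs 1 ((fun z : H => y * z) @^-1` ~` range f).
    apply: (@mulgl_continuous H y 1); rewrite mulg1; apply: open_nbhs_nbhs; split.
      by rewrite openC.
    by move=> [x _ fx]; apply: yI; exists x.
  move=> /(zassenhaus_nbhs p_pr pH)[i i0 Di].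
  have [_ /(_ y)[x yx] _] := fapp i.
  have /Di /= : zassenhaus p H i (y^-1 * f x).
    by apply: (@zassenhaus_le p H i i.+2 p1 i0) yx; exact: leq_trans (leqnSn _) (leqnSn _).
  by rewrite mulKVg; apply; exists x.
- move=> x; split=> x1; apply: D2 => // i; have [fD _ _] := fapp i.
    by apply/fD; rewrite x1; have [_ []] := zassenhaus_closed_subgroup p G i.+2.
  by apply/fD; rewrite x1; have [_ []] := zassenhaus_closed_subgroup p H i.+2.
Qed.

Lemma Sch_presented (c : Sch p_pr F) :
  exists (n : nat) (r : relators F n), c = Theta p_pr F n r.
Proof.
have [G ->] := iso_class_surj c; have [_ [n [r Gr]]] := ws_weak_schur G.
by exists n, r; apply/iso_classP.
Qed.

Lemma Sch_hausdorff : hausdorff_space (Sch p_pr F).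
Proof.
move=> c d; have [n [r ->]] := Sch_presented c; have [m [s ->]] := Sch_presented d.
move=> cl; apply/iso_classP; apply: presented_separated => i i2.
have nb (G : weakSchur F) : nbhs (iso_class p_pr G) (sch_nbhs i G).
  apply: open_nbhs_nbhs; split; last by apply/sch_nbhsP; exact: sigma_iso_refl.
  by apply: (sch_basisP p_pr F).1; exists i, G.
have [e []] := cl _ _ (nb (presented_ws r)) (nb (presented_ws s)).
have [G ->] := iso_class_surj e => /sch_nbhsP Gr /sch_nbhsP Gs.
exact: sigma_iso_trans (sigma_iso_sym Gr) Gs.
Qed.

Lemma Theta_range n : range (Theta p_pr F n) = Sch_le p_pr F n.
Proof.
have up a b (r : relators F a) : a <= b -> exists r' : relators F b,
    sigma_iso (presented r) (presented r').
  move=> /subnK <-; elim: (b - a)%N => [|k [r' rr']]; first by exists r; exact: sigma_iso_refl.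
  have [r'' r'r''] := presented_extend p_pr r'; exists r''; exact: sigma_iso_trans rr' r'r''.
have down a d (r : relators F a) : has_gen_rank p (presented r) d -> d <= n -> n <= a ->
    exists r' : relators F n, sigma_iso (presented r) (presented r').
  move=> rd dn; elim: a r rd => [|a IH] r rd.
    by rewrite leqn0 => /eqP n0; move: r rd; rewrite -n0 => r rd; exists r; exact: sigma_iso_refl.
  rewrite leq_eqVlt => /predU1P[na|na].
    by move: r rd; rewrite -na => r rd; exists r; exact: sigma_iso_refl.
  have [j [f fH fj]] := gen_rank_relator p_pr rd (leq_ltn_trans dn na).
  have [r' rr'] := presented_reduce p_pr fH fj.
  have [|r'' r'r''] := IH r' _ na; first exact/(has_gen_rank_iso p _ rr').
  by exists r''; exact: sigma_iso_trans rr' r'r''.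
apply/seteqP; split=> [_ [r _ <-]|_ [G [-> [d Gd dn]]]].
  exists (presented_ws r); split=> //.
  exact: (has_gen_rank_ex p_pr (presented_gen p_pr r)).
have [_ [a [r Gr]]] := ws_weak_schur G.
have [r' rr'] : exists r' : relators F n, sigma_iso (presented r) (presented r').
  have [an|/ltnW na] := leqP a n; first exact: up.
  exact: (down a d r ((has_gen_rank_iso p d Gr).1 Gd) dn na).
exists r' => //; apply/iso_classP; apply: sigma_iso_sym; exact: sigma_iso_trans Gr rr'.
Qed.

Lemma Sch_eq_closed n : closed (Sch_eq p_pr F n).
Proof.
rewrite -openC openE => c; have [G ->] := iso_class_surj c => Gn.
rewrite /interior nbhsE; exists (sch_nbhs 2 G); first split.
- by apply: (sch_basisP p_pr F).1; exists 2%N, G.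
- by apply/sch_nbhsP; exact: sigma_iso_refl.
move=> _ [H [-> HG]] [K [/iso_classP HK Kn]]; apply: Gn; exists G; split=> //.
have Hn := (has_gen_rank_iso p n HK).2 Kn.
apply/(has_gen_rank_zassenhaus2 p_pr G n)/(has_gen_rank_iso p n HG).
exact/(has_gen_rank_zassenhaus2 p_pr H n).
Qed.

End Separation.

(* Continuity, quotient topology and compactness *)
Local Close Scope group_scope.

Theorem proposition8p3 (p : nat) (p_pr : prime p) (p_gt2 : 2 < p)
    (F : forall m : nat, freeSigmaProP p m) (n : nat) :
  [/\ continuous (Theta p_pr F n),
      range (Theta p_pr F n) = Sch_le p_pr F n /\
        (forall A : set (Sch_le p_pr F n),
          open A <-> open (Theta p_pr F n @^-1` (set_val @` A))),
      compact (Sch_le p_pr F n)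
    & compact (Sch_eq p_pr F n)].
Proof.
have Tc : continuous (Theta p_pr F n) by exact: Theta_continuous.
have cR : compact [set: relators F n] by exact: relators_compact.
have TR := Theta_range p_pr F n.
have cle : compact (Sch_le p_pr F n).
  by rewrite -TR; apply: continuous_compact cR; exact: continuous_subspaceT.
split=> //; last first.
  have eq_le : Sch_eq p_pr F n `<=` Sch_le p_pr F n.
    by move=> _ [G [-> Gn]]; exists G; split=> //; exists n.
  exact: subclosed_compact (Sch_eq_closed (n := n)) cle eq_le.
split=> // A; split=> [[B oB <-]|oA].
  have -> : Theta p_pr F n @^-1` (set_val @` (set_val @^-1` B : set (Sch_le p_pr F n))) =
      Theta p_pr F n @^-1` B.
    apply/seteqP; split=> r /=; first by move=> [c Bc <-].
    have Tr : Sch_le p_pr F n (Theta p_pr F n r) by rewrite -TR; exists r.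
    by move=> Br; exists (SigSub (mem_set Tr)).
  by apply: open_comp => // r _; exact: Tc.
(* The image of the closed set of those [r] whose class is not in [A] is closed in [Sch]; its
   complement meets [Sch_le] exactly in [A], because every class in [Sch_le] is attained. *)
exists (~` (Theta p_pr F n @` (~` (Theta p_pr F n @^-1` (set_val @` A))))).
  rewrite /= openC; apply: compact_map_closed => //; first exact: Sch_hausdorff.
  by rewrite closedC.
apply/seteqP; split=> c /=.
  move=> cA; have : range (Theta p_pr F n) (set_val c) by rewrite TR; exact: set_valP.
  move=> [r _ rc]; apply: contrapT => Ac; apply: cA; exists r => // -[a Aa].
  by rewrite rc => /val_inj ac; rewrite ac in Aa.
by move=> Ac [r nr rc]; apply: nr; exists c.
Qed.
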